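(* Let $\mathcal{G}$ be a compact metric graph with total length $|\mathcal{G}|=L>0$ and $E$ edges. Then $$\frac{2E-1}{4E^2}\,L \le \rho(\mathcal{G}) \le \frac{L}{3}.$$ Equality holds in the lower bound if and only if $\mathcal{G}$ is an equilateral flower graph. Equality holds in the upper bound if and only if $\mathcal{G}$ is a path graph (i.e. an interval). If $\mathcal{G}$ is moreover doubly connected, then $\rho(\mathcal{G}) \le L/4$, with equality if and only if $\mathcal{G}$ is a loop.
   Context: A compact metric graph $\mathcal{G}$ is a connected graph with finitely many vertices and finitely many edges. Loops and multiple edges are allowed. Each edge $e$ is identified with an interval $(0,\ell_e)$ with $\ell_e>0$. The graph carries the shortest-path distance $\operatorname{dist}$ and Lebesgue measure on the edges, and its total length is $|\mathcal{G}|=\sum_e\ell_e$. The mean distance is $\rho(\mathcal{G})=\frac{1}{|\mathcal{G}|^2}\int_{\mathcal{G}}\int_{\mathcal{G}}\operatorname{dist}(x,y)\,\mathrm{d}y\,\mathrm{d}x$. A flower graph on $m$ edges has exactly one vertex, with all $m$ edges being loops attached at both ends to that vertex. It is equilateral if all edges have the same length. A path graph is a metric graph isometric to a compact interval. A loop is a metric graph isometric to a circle. $\mathcal{G}$ is doubly connected if for any $x,y\in\mathcal{G}$ there exist two edgewise disjoint paths from $x$ to $y$; equivalently, no edge is a bridge. *)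

(* Defs.v *)
From HB Require Import structures.
From mathcomp Require Import all_boot all_order all_algebra.
From mathcomp Require Import all_classical all_reals all_analysis.

Set Implicit Arguments.
Unset Strict Implicit.
Unset Printing Implicit Defensive.

Import Order.TTheory GRing.Theory Num.Theory.

Local Open Scope classical_set_scope.
Local Open Scope ring_scope.

(* The orientation of an edge (org at 0, dst at len) is a mere
   parametrization; adjacency ignores it. *)
Definition adjacent (V E : finType) (org dst : E -> V) : rel V :=
  fun v w => [exists e, ((org e == v) && (dst e == w))
                     || ((org e == w) && (dst e == v))].

Record metric_graph (R : realType) := MetricGraph {
  vertex : finType;
  edge : finType;
  org : edge -> vertex;
  dst : edge -> vertex;
  len : edge -> R;
  len_gt0 : forall e, 0 < len e;
  graph_connected : forall v w, connect (adjacent org dst) v w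
}.

Section MetricGraphs.
Variables (R : realType) (G : metric_graph R).

Definition point : Type :=
  (vertex G + {u : edge G * R | 0 < u.2 < len u.1})%type.

(* The point of coordinate t on the closed edge e, for 0 <= t <= len e;
   coordinates 0 and len e are the end vertices of e. *)
Definition at_edge (e : edge G) (t : R) : point :=
  match (insub (e, t) : option {u : edge G * R | 0 < u.2 < len u.1}) with
  | Some u => inr u
  | None => inl (if t <= 0 then org e else dst e)
  end.

(* (e, s, t) is the part of the closed edge e travelled from coordinate s to
   coordinate t, in either direction. *)
Definition segment : Type := (edge G * R * R)%type.
Definition seg_edge (s : segment) : edge G := s.1.1.
Definition seg_from (s : segment) : R := s.1.2.
Definition seg_to (s : segment) : R := s.2.

Definition valid_segment (s : segment) : Prop :=
  0 <= seg_from s <= len (seg_edge s) /\ 0 <= seg_to s <= len (seg_edge s).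

Fixpoint is_path (x : point) (p : seq segment) (y : point) : Prop :=
  match p with
  | [::] => x = y
  | s :: p' =>
      [/\ valid_segment s, x = at_edge (seg_edge s) (seg_from s)
        & is_path (at_edge (seg_edge s) (seg_to s)) p' y]
  end.

Definition path_length (p : seq segment) : R :=
  \sum_(s <- p) `|seg_to s - seg_from s|.

Definition dist (x y : point) : R :=
  inf [set path_length p | p in [set p | is_path x p y]].

Definition total_length : R := \sum_(e : edge G) len e.

Definition graph_integral (f : point -> R) : R :=
  \sum_(e : edge G)
    \int[lebesgue_measure]_(t in `]0, len e[) f (at_edge e t).

Definition mean_distance : R :=
  (total_length ^+ 2)^-1 *
  graph_integral (fun x => graph_integral (fun y => dist x y)).

Definition equilateral_flower : Prop :=
  [/\ #|vertex G| = 1%N, forall e : edge G, org e = dst e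
    & forall e f : edge G, len e = len f].

Definition isometric_to (A : set R) (d : R -> R -> R) : Prop :=
  exists f : point -> R,
    range f = A /\ forall x y, d (f x) (f y) = dist x y.

Definition path_graph : Prop :=
  exists a b : R, a <= b /\ isometric_to `[a, b] (fun s t => `|s - t|).

(* Arc-length distance on the circle of circumference c, parametrized by
   arc length in [0, c[. *)
Definition circle_dist (c s t : R) : R :=
  Num.min `|s - t| (c - `|s - t|).

Definition loop_graph : Prop :=
  exists c : R, 0 < c /\ isometric_to `[0, c[ (circle_dist c).

Definition seg_interior (s : segment) : set R :=
  `]Num.min (seg_from s) (seg_to s), Num.max (seg_from s) (seg_to s)[.

(* x and y may lie inside edges, so an edge may be shared by two edgewise
   disjoint paths as long as they travel non-overlapping parts of it:
   equivalently, edges are compared once x and y are made vertices. *)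
Definition edgewise_disjoint (p q : seq segment) : Prop :=
  forall s s', s \in p -> s' \in q -> seg_edge s = seg_edge s' ->
    seg_interior s `&` seg_interior s' = set0.

Definition doubly_connected : Prop :=
  forall x y : point, exists p q : seq segment,
    [/\ is_path x p y, is_path x q y & edgewise_disjoint p q].

End MetricGraphs.

(* Main.v *)
Require Import Defs.
From HB Require Import structures.
From mathcomp Require Import all_boot all_order all_algebra.
From mathcomp Require Import all_classical all_reals all_analysis.
From mathcomp Require Import ring lra.
(* MathComp-Analysis shadows [point]. *)
Import Defs.

(* Lower bound: a geodesic between points of different edges e, f runs through
   an end of each, and on one edge the distance is at least that of the circle
   obtained by gluing the ends. Integrating, with l_e the lengths, gives
   L^2 rho >= sum_e (L l_e^2 / 2 - l_e^3 / 4), whose summand lies above its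
   tangent at the mean length L / E. In the equality case all lengths agree and
   all vertices are at distance 0.

   Upper bound L / 3: build the graph one edge at a time, each new edge of length
   l attached at a vertex v of the part S already built. Bounding distances to
   the new edge by paths through v, the double integral of the distance grows by
   at most l |S|^2 + l^2 |S| + l^3 / 3 = ((|S| + l)^3 - |S|^3) / 3. Equality
   forces S to be an interval at each stage, with v one of its ends. Conversely,
   for an interval of length D >= L the same induction is tight, and D >= L
   because r-separated points of the graph remain r-separated in the interval.

   Upper bound L / 4: a doubly connected graph is bridgeless, so it is built from
   a cycle through a given point x by adding ears (trails with both ends in the
   part S already built). Inductively dist(x, .) <= |S| / 2 on S and its integral
   is at most |S|^2 / 4. An ear attached at x itself would make this strict, so
   equality for all x leaves no room for ears: the graph is one cycle, on which
   the distance is that of the circle. Conversely, on a circle the distances to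
   two antipodal points add up to half the circumference. *)

Set Implicit Arguments.
Unset Strict Implicit.
Unset Printing Implicit Defensive.

Import Order.TTheory GRing.Theory Num.Theory.
Import numFieldNormedType.Exports.

Local Open Scope classical_set_scope.
Local Open Scope ring_scope.

(** * Integrals of Lipschitz functions *)

Section Integral.
Variable R : realType.
Implicit Types (a b c l s t K : R) (phi psi : R -> R).

(** A Lipschitz condition rather than continuity: it is stable under the operations below, gives
    integrability, and makes the neighbourhood in [itg_eq] explicit. *)
Definition lip a b phi : Prop := exists2 K, 0 <= K &
  forall s t, a <= s <= b -> a <= t <= b -> `|phi s - phi t| <= K * `|s - t|.

Definition itg a b phi : R := \int[lebesgue_measure]_(t in `[a, b]) phi t.

Lemma lipW a b c d phi : a <= c -> d <= b -> lip a b phi -> lip c d phi.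
Proof.
move=> ac db [K K0 H]; exists K => // s t /andP[cs sd] /andP[ct td].
by apply: H; apply/andP; split; lra.
Qed.

Lemma lip_cont a b phi : a <= b -> lip a b phi ->
  {within `[a, b], continuous phi}.
Proof.
move=> ab [K K0 H].
(* [cl] clamps the line onto [[a, b]] without increasing distances, so [phi \o cl] is continuous
   everywhere and agrees with [phi] on the interval. *)
pose cl t := Num.max a (Num.min t b).
have clab t : a <= cl t <= b.
  rewrite /cl /Num.max /Num.min; case: (ltP t b) => ?.
    by case: (ltP a t) => ?; apply/andP; split; lra.
  by case: (ltP a b) => ?; apply/andP; split; lra.
have clE t : a <= t <= b -> cl t = t.
  by move=> /andP[at_ tb]; rewrite /cl (min_idPl tb) (max_idPr at_).
have cl1 s t : `|cl s - cl t| <= `|s - t|.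
  rewrite /cl /Num.max /Num.min.
  have := ler_norm (s - t); have := ler_norm (t - s); rewrite (distrC t s).
  move: `|s - t| => n h1 h2.
  case: (ltP s b) => ?; case: (ltP t b) => ?;
    repeat (let h := fresh in case: (ltP a _) => h); rewrite ler_norml;
    apply/andP; split; try lra.
have : {within `[a, b], continuous (phi \o cl)}.
  apply: continuous_subspaceT => x.
  apply/cvgrPdist_lt => e e0.
  have d0 : 0 < e / (K + 1) by apply: divr_gt0 => //; lra.
  near=> y => /=.
  have h : `|phi (cl x) - phi (cl y)| <= K * `|x - y|.
    by apply: (le_trans (H _ _ (clab _) (clab _))); rewrite ler_wpM2l.
  apply: (le_lt_trans h).
  have : `|x - y| < e / (K + 1).
    by near: y; exists (e / (K + 1)).
  rewrite ltr_pdivlMr; last by lra.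
  by move=> hh; apply: le_lt_trans hh; rewrite mulrC ler_wpM2l//; lra.
apply: subspace_eq_continuous => x; rewrite inE/= in_itv/= => xab.
by congr phi; exact: clE.
Unshelve. all: by end_near. Qed.

Lemma lip_integrable a b phi : lip a b phi ->
  (@lebesgue_measure R).-integrable `[a, b] (EFin \o phi).
Proof.
move=> lp; have [ab|ba] := leP a b; last first.
  by rewrite set_itv_ge ?bnd_simp ?lt_geF// ; exact: integrable_set0.
apply: continuous_compact_integrable; first exact: segment_compact.
exact: lip_cont.
Qed.

(** Endpoints are null sets; this passes from the open edges of [graph_integral] to closed ones. *)
Lemma itg_open l phi : lip 0 l phi ->
  \int[lebesgue_measure]_(t in `]0, l[) phi t = itg 0 l phi.
Proof.
move=> /lip_integrable h; rewrite /itg -Rintegral_itv_bndo_bndc.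
  rewrite -Rintegral_itv_obnd_cbnd//.
  by apply: integrableS h => //; apply: subset_itv; rewrite bnd_simp.
by apply: integrableS h => //; apply: subset_itv; rewrite bnd_simp.
Qed.

Lemma eq_itg a b phi psi : (forall t, a <= t <= b -> phi t = psi t) ->
  itg a b phi = itg a b psi.
Proof.
by move=> h; apply: eq_Rintegral => t; rewrite inE/= in_itv/= => /h.
Qed.

Lemma itg_le a b phi psi : lip a b phi -> lip a b psi ->
  (forall t, a <= t <= b -> phi t <= psi t) -> itg a b phi <= itg a b psi.
Proof.
by move=> /lip_integrable h1 /lip_integrable h2 h; exact: le_Rintegral.
Qed.

Lemma itgD a b phi psi : lip a b phi -> lip a b psi ->
  itg a b (fun t => phi t + psi t) = itg a b phi + itg a b psi.
Proof. by move=> /lip_integrable ? /lip_integrable ?; exact: RintegralD. Qed.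

Lemma itgZ a b c phi : lip a b phi ->
  itg a b (fun t => c * phi t) = c * itg a b phi.
Proof. by move=> /lip_integrable ?; exact: RintegralZl. Qed.

Lemma itg_cst a b c : a <= b -> itg a b (fun=> c) = c * (b - a).
Proof.
move=> ab; rewrite /itg Rintegral_cst//= lebesgue_measure_itv/= lte_fin.
case: (ltP a b) => [_|ba] //=; have -> : b - a = 0 by lra.
by rewrite mulr0.
Qed.

Lemma itg_point a phi : itg a a phi = 0.
Proof. by rewrite /itg set_itv1 Rintegral_set1. Qed.

Lemma itg_split a b c phi : a <= b -> b <= c -> lip a c phi ->
  itg a c phi = itg a b phi + itg b c phi.
Proof.
move=> ab bc lp; have h := lip_integrable lp.
have := @Rintegral_itvB R phi (BLeft a) (BRight c) b h.
rewrite !bnd_simp => /(_ ab bc).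
rewrite Rintegral_itv_obnd_cbnd; last first.
  by apply: integrableS h => //; apply: subset_itv; rewrite !bnd_simp.
by rewrite /itg => <-; rewrite addrC subrK.
Qed.

Lemma lip_comp a b a' b' phi psi : lip a b phi -> lip a' b' psi ->
  (forall t, a' <= t <= b' -> a <= psi t <= b) -> lip a' b' (phi \o psi).
Proof.
move=> [K K0 H] [K' K'0 H'] h; exists (K * K'); first exact: mulr_ge0.
move=> s t hs ht /=; apply: le_trans (H _ _ (h _ hs) (h _ ht)) _.
by rewrite -mulrA ler_wpM2l// H'.
Qed.

Lemma lip_cst a b c : lip a b (fun=> c).
Proof. by exists 0 => // s t _ _; rewrite subrr normr0 mul0r. Qed.

Lemma lip_id a b : lip a b id.
Proof. by exists 1 => // s t _ _; rewrite mul1r. Qed.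

Lemma lipD a b phi psi : lip a b phi -> lip a b psi ->
  lip a b (fun t => phi t + psi t).
Proof.
move=> [K K0 H] [K' K'0 H']; exists (K + K'); first exact: addr_ge0.
move=> s t hs ht; rewrite opprD addrACA mulrDl.
by apply: le_trans (ler_normD _ _) (lerD _ _); [exact: H|exact: H'].
Qed.

Lemma lipZ a b c phi : lip a b phi -> lip a b (fun t => c * phi t).
Proof.
move=> [K K0 H]; exists (`|c| * K); first exact: mulr_ge0.
by move=> s t hs ht; rewrite -mulrBr normrM -mulrA ler_wpM2l// H.
Qed.

Lemma lipN a b phi : lip a b phi -> lip a b (fun t => - phi t).
Proof.
move=> [K K0 H]; exists K => // s t hs ht.
by rewrite -opprD normrN H.
Qed.

Lemma lip_abs a b phi : lip a b phi -> lip a b (fun t => `|phi t|).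
Proof.
move=> [K K0 H]; exists K => // s t hs ht.
by apply: le_trans (H _ _ hs ht); exact: ler_dist_dist.
Qed.

Lemma lip_min a b phi psi : lip a b phi -> lip a b psi ->
  lip a b (fun t => Num.min (phi t) (psi t)).
Proof.
move=> [K K0 H] [K' K'0 H']; exists (K + K'); first exact: addr_ge0.
move=> s t hs ht.
have := H _ _ hs ht; have := H' _ _ hs ht.
have := mulr_ge0 K0 (normr_ge0 (s - t)).
have := mulr_ge0 K'0 (normr_ge0 (s - t)).
rewrite mulrDl; set u := K * _; set v := K' * _ => v0 u0.
rewrite !ler_norml => /andP[h1 h2] /andP[h3 h4].
rewrite /Num.min; case: (ltP (phi s)) => ?; case: (ltP (phi t)) => ?;
  apply/andP; split; lra.
Qed.

Lemma itg_shift a b c phi : a <= b -> lip (a + c) (b + c) phi ->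
  itg (a + c) (b + c) phi = itg a b (fun t => phi (t + c)).
Proof.
move=> ab lp; rewrite /itg /Rintegral; congr fine.
have D : derive1 (fun t : R => t + c) = cst (1 : R).
  apply/funext => x.
  have d : is_derive x 1 (fun t : R => t + c) 1.
    by apply: is_derive_eq; rewrite addr0.
  by rewrite derive1E derive_val.
have cs (x : R) : {for x, continuous (fun t : R => t + c)}.
  by apply: continuousD => //; exact: cst_continuous.
rewrite (@integration_by_substitution_increasing R (fun t => t + c))//.
- apply: eq_integral => t _ /=; congr EFin.
  by rewrite !fctE/= D mulr1.
- by move=> x y _ _; rewrite ltrD2r.
- by move=> x _; rewrite D; exact: cvg_cst.
- by rewrite D; exact: is_cvg_cst.
- by rewrite D; exact: is_cvg_cst.
- split => //.
  + by apply: cvg_at_right_filter; exact: cs.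
  + by apply: cvg_at_left_filter; exact: cs.
- by apply: lip_cont => //; rewrite lerD2r.
Qed.

Lemma itg_opp a b phi : a <= b -> lip (- b) (- a) phi ->
  itg (- b) (- a) phi = itg a b (fun t => phi (- t)).
Proof.
move=> ab lp; rewrite /itg /Rintegral; congr fine.
rewrite integration_by_substitution_oppr//.
by apply: lip_cont => //; lra.
Qed.

Lemma itg_rev l phi : 0 <= l -> lip 0 l phi ->
  itg 0 l (fun t => phi (l - t)) = itg 0 l phi.
Proof.
move=> l0 lp.
have lp' : lip (- l) 0 (fun t => phi (t + l)).
  apply: (@lip_comp 0 l _ _ phi (fun t => t + l)) => //.
    by apply: lipD; [exact: lip_id|exact: lip_cst].
  by move=> t /andP[? ?]; apply/andP; split; lra.
have := @itg_opp 0 l (fun t => phi (t + l)) l0.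
rewrite oppr0 => /(_ lp') => h.
rewrite (@eq_itg 0 l _ (fun t => phi (- t + l))); last first.
  by move=> t _; rewrite addrC.
rewrite -h -(@itg_shift (- l) 0 l phi) ?addNr ?add0r//; lra.
Qed.

Lemma itg_FTC a b phi (F : R -> R) : a <= b -> lip a b phi ->
  (forall x : R, is_derive x 1 F (phi x)) -> itg a b phi = F b - F a.
Proof.
rewrite le_eqVlt => /predU1P[<- _ _|ab lp dF]; first by rewrite itg_point subrr.
rewrite /itg /Rintegral (@continuous_FTC2 R phi F)//.
- exact: lip_cont (ltW ab) lp.
- have cF (x : R) : {for x, continuous F}.
    by apply/differentiable_continuous/derivable1_diffP.
  split => //.
  + by apply: cvg_at_right_filter; exact: cF.
  + by apply: cvg_at_left_filter; exact: cF.
- by move=> x _; rewrite derive1E derive_val.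
Qed.

Lemma lip_sqr a b : lip a b (fun t : R => t ^+ 2).
Proof.
exists ((`|a| + `|b|) *+ 2); first by rewrite mulrn_wge0// addr_ge0.
move=> s t /andP[as_ sb] /andP[at_ tb].
rewrite subr_sqr normrM mulrC ler_wpM2r// mulr2n.
have h u : a <= u -> u <= b -> `|u| <= `|a| + `|b|.
  move=> au ub; rewrite ler_norml.
  have := ler_norm b; have := ler_norm (- a); rewrite normrN.
  have := normr_ge0 a; have := normr_ge0 b; move=> *.
  by apply/andP; split; lra.
by apply: le_trans (ler_normD _ _) (lerD _ _); exact: h.
Qed.

Lemma itg_id a b : a <= b -> itg a b id = (b ^+ 2 - a ^+ 2) / 2.
Proof.
move=> ab; have d (x : R) : is_derive x (1 : R) (fun t : R => t ^+ 2 / 2) x.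
  by apply: is_derive_eq; rewrite /= /GRing.scale/=; field.
by rewrite (itg_FTC ab (lip_id a b) d); field.
Qed.

Lemma itg_sqr a b : a <= b ->
  itg a b (fun t => t ^+ 2) = (b ^+ 3 - a ^+ 3) / 3.
Proof.
move=> ab.
have d (x : R) : is_derive x (1 : R) (fun t : R => t ^+ 3 / 3) (x ^+ 2).
  by apply: is_derive_eq; rewrite /= /GRing.scale/=; field.
by rewrite (itg_FTC ab (lip_sqr a b) d); field.
Qed.

(** The source of all equality cases: if the gap [g] were positive at [t0], it would stay above half
    that value on an interval of positive length, and its integral would be positive. *)
Lemma itg_eq a b phi psi : a < b -> lip a b phi -> lip a b psi ->
  (forall t, a <= t <= b -> phi t <= psi t) -> itg a b psi <= itg a b phi ->
  forall t, a <= t <= b -> phi t = psi t.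
Proof.
move=> ab lp lq h e t0 /andP[at0 t0b].
apply/eqP; rewrite eq_le h ?at0//= leNgt; apply/negP => lt0.
pose g t := psi t + - phi t.
have [K K0 H] : lip a b g by apply: lipD => //; exact: lipN.
have lg : lip a b g by exists K.
have g0 t : a <= t <= b -> 0 <= g t by move=> /h; rewrite /g; lra.
have gt0 : 0 < g t0 by rewrite /g; lra.
(* Moving by [d] changes [g] by at most half of [g t0]; [K + 1] avoids dividing by zero when [K]
   vanishes. *)
have [d d0 dE] : exists2 d, 0 < d & g t0 / 2 = (K + 1) * d.
  by exists (g t0 / (2 * (K + 1))); [rewrite divr_gt0//; lra|field; lra].
(* [t0] may be an end of [[a, b]], so the neighbourhood is cut to the interval. *)
have [p [q [ap pq qb pt tq]]] : exists p q,
    [/\ a <= p, p < q, q <= b, t0 - d <= p & q <= t0 + d].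
  exists (Num.max a (t0 - d)), (Num.min b (t0 + d)); rewrite /Num.max /Num.min.
  by case: (ltP a) => ?; case: (ltP b) => ?; split; lra.
have gpq t : p <= t <= q -> g t0 / 2 <= g t.
  move=> /andP[? ?].
  have := H t0 t; rewrite at0 t0b => /(_ isT).
  have -> : a <= t <= b by apply/andP; split; lra.
  move=> /(_ isT); have : K * `|t0 - t| <= K * d.
    by rewrite ler_wpM2l// ler_norml; apply/andP; split; lra.
  have : K * d <= g t0 / 2.
    by rewrite dE ler_wpM2r// ?ltW//; lra.
  by rewrite ler_norml; move=> ? ? /andP[? ?]; lra.
have lgs c d' : a <= c -> d' <= b -> lip c d' g by move=> ? ?; exact: lipW lg.
have : itg a b g <= 0.
  rewrite /g itgD//; last exact: lipN.
  rewrite (@eq_itg a b (fun t => - phi t) (fun t => (-1) * phi t)); last first.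
    by move=> t _; rewrite mulN1r.
  by rewrite itgZ//; lra.
rewrite (@itg_split a p b)//; [|lra].
rewrite (@itg_split p q b)//; [|lra|exact: lgs].
have i0 c d' : a <= c -> c <= d' -> d' <= b -> 0 <= itg c d' g.
  move=> ac cd db; rewrite -[leLHS](mul0r (d' - c)) -(itg_cst 0 cd).
  apply: itg_le; [exact: lip_cst|exact: lgs|].
  by move=> t /andP[? ?]; apply: g0; apply/andP; split; lra.
have := i0 a p (lexx _) ap; have := i0 q b _ qb (lexx _).
have : g t0 / 2 * (q - p) <= itg p q g.
  rewrite -itg_cst ?(ltW pq)//.
  by apply: itg_le; [exact: lip_cst|apply: lgs; lra|exact: gpq].
have : 0 < g t0 / 2 * (q - p) by apply: mulr_gt0; lra.
move=> ? ? /(_ _) h1 ?.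
have : 0 <= itg q b g by apply: h1; lra.
have : 0 <= itg a p g by apply: i0 => //; lra.
by lra.
Qed.

End Integral.

(** * The path metric *)

Section Distance.
Variables (R : realType) (G : metric_graph R).
Implicit Types (x y z : point G) (p q : seq (segment G)) (e f : edge G).
Implicit Types (s t r : R) (v w : vertex G).

Lemma at_edge0 e : at_edge e 0 = inl (org e).
Proof. by rewrite /at_edge insubF/= ?ltxx// lexx. Qed.

Lemma at_edge_len e : at_edge e (len e) = inl (dst e).
Proof. by rewrite /at_edge insubF/= ?ltxx ?andbF// leNgt len_gt0. Qed.

Lemma at_edge_in e t (h : 0 < t < len e) :
  at_edge e t = inr (exist (fun u : edge G * R => 0 < u.2 < len u.1) (e, t) h).
Proof. by rewrite /at_edge; case: insubP => [u ? ue|/negP//]; congr inr; exact/val_inj. Qed.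

Lemma len_ge0 e : 0 <= len e. Proof. exact/ltW/len_gt0. Qed.

Lemma point_cases x : (exists v, x = inl v) \/
  (exists e t, 0 < t < len e /\ x = at_edge e t).
Proof.
case: x => [v|[[e t] h]]; [by left; exists v|right].
by exists e, t; split=> //; rewrite (at_edge_in h).
Qed.

(* A function on the graph from compatible values on vertices and edges; by
   [pot_le_dist], the 1-Lipschitz ones bound the distance from below. *)
Definition pot (T : Type) (hv : vertex G -> T) (he : edge G -> R -> T) x : T :=
  match x with inl v => hv v | inr u => he (val u).1 (val u).2 end.

Lemma pot_at_edge (T : Type) (hv : vertex G -> T) he e t : he e 0 = hv (org e) -> he e (len e) = hv (dst e) ->
  0 <= t <= len e -> pot hv he (at_edge e t) = he e t.
Proof.
move=> h0 h1 /andP[]; rewrite le_eqVlt => /predU1P[<-|t0].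
  by rewrite at_edge0 h0.
rewrite le_eqVlt => /predU1P[->|tl]; first by rewrite at_edge_len h1.
have h : 0 < t < len e by rewrite t0.
by rewrite (at_edge_in h).
Qed.

Lemma is_path_cat x p y q z : is_path x p y -> is_path y q z ->
  is_path x (p ++ q) z.
Proof.
elim: p x => [x /= -> //|s p IH x /= [vs xs h] hq]; split => //.
exact: IH.
Qed.

Definition srev (s : segment G) : segment G := (seg_edge s, seg_to s, seg_from s).

Lemma is_path_rev x p y : is_path x p y -> is_path y (rev (map srev p)) x.
Proof.
elim: p x => [x /= -> //|s p IH x /= [[v1 v2] xs /IH h]].
by rewrite rev_cons -cats1; apply: is_path_cat h _; split => //; split.
Qed.

Lemma path_length_rev p : path_length (rev (map srev p)) = path_length p.
Proof.
rewrite /path_length big_rev big_map; apply: eq_bigr => s _.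
by rewrite distrC.
Qed.

Lemma path_length_cat p q : path_length (p ++ q) = path_length p + path_length q.
Proof. by rewrite /path_length big_cat. Qed.

Lemma path_length_ge0 p : 0 <= path_length p.
Proof. by rewrite /path_length sumr_ge0. Qed.

Lemma is_path_seg e s t : 0 <= s <= len e -> 0 <= t <= len e ->
  is_path (at_edge e s) [:: (e, s, t)] (at_edge e t).
Proof. by move=> hs ht; split. Qed.

Lemma in0l e : (0 : R) <= 0 <= len e. Proof. by rewrite lexx len_ge0. Qed.
Lemma inll e : 0 <= len e <= len e. Proof. by rewrite lexx len_ge0. Qed.

Lemma path_exists_vertex v w : exists p, is_path (inl v : point G) p (inl w).
Proof.
have /connectP[q] := graph_connected v w.
elim: q v => [v _ ->|u q IH v /= /andP[/existsP[e he] hq] wE]; first by exists [::].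
have [p hp] := IH u hq wE.
case/orP: he => /andP[/eqP h1 /eqP h2].
- exists ((e, 0, len e) :: p); split; rewrite ?at_edge0 ?at_edge_len ?h1 ?h2//.
  by split; [exact: in0l|exact: inll].
- exists ((e, len e, 0) :: p); split; rewrite ?at_edge0 ?at_edge_len ?h1 ?h2//.
  by split; [exact: inll|exact: in0l].
Qed.

Lemma path_to_vertex x : exists v p, is_path x p (inl v).
Proof.
case: (point_cases x) => [[v ->]|[e [t [/andP[t0 tl] ->]]]].
  by exists v, [::].
exists (org e), [:: (e, t, 0)]; rewrite -at_edge0.
by apply: is_path_seg; rewrite ?in0l// !ltW.
Qed.

Lemma path_exists x y : exists p, is_path x p y.
Proof.
have [v [p hp]] := path_to_vertex x; have [w [q hq]] := path_to_vertex y.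
have [m hm] := path_exists_vertex v w.
exists (p ++ (m ++ rev (map srev q))); apply: is_path_cat hp _.
by apply: is_path_cat hm _; exact: is_path_rev.
Qed.

Lemma dist_le_path x p y : is_path x p y -> dist x y <= path_length p.
Proof.
move=> h; apply: ge_inf; last by exists p.
by exists 0 => _ [q _ <-]; exact: path_length_ge0.
Qed.

Lemma le_dist x y r : (forall p, is_path x p y -> r <= path_length p) ->
  r <= dist x y.
Proof.
move=> h; apply: lb_le_inf.
  by have [p hp] := path_exists x y; exists (path_length p), p.
by move=> _ [p hp <-]; exact: h.
Qed.

Lemma dist_ge0 x y : 0 <= dist x y.
Proof. by apply: le_dist => p _; exact: path_length_ge0. Qed.

Lemma distxx x : dist x x = 0.
Proof.
apply/eqP; rewrite eq_le dist_ge0 andbT.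
by apply: le_trans (@dist_le_path x [::] x erefl) _; rewrite /path_length big_nil.
Qed.

Lemma dist_sym x y : dist x y = dist y x.
Proof.
have h (u u' : point G) : dist u u' <= dist u' u.
  apply: le_dist => p /is_path_rev/dist_le_path.
  by rewrite path_length_rev.
by apply/eqP; rewrite eq_le !h.
Qed.

Lemma dist_tri y x z : dist x z <= dist x y + dist y z.
Proof.
rewrite -lerBlDl; apply: le_dist => q hq.
rewrite lerBlDl -lerBlDr; apply: le_dist => p hp.
by rewrite lerBlDr -path_length_cat; apply/dist_le_path/(is_path_cat hp hq).
Qed.

Lemma dist_edge e s t : 0 <= s <= len e -> 0 <= t <= len e ->
  dist (at_edge e s) (at_edge e t) <= `|s - t|.
Proof.
move=> hs ht; apply: le_trans (dist_le_path (is_path_seg hs ht)) _.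
by rewrite /path_length big_seq1 distrC.
Qed.

Lemma dist_lip x y z : `|dist x z - dist y z| <= dist x y.
Proof.
have := dist_tri y x z; have := dist_tri x y z; rewrite (dist_sym y x).
by rewrite ler_norml => ? ?; apply/andP; split; lra.
Qed.

(** Along a path the increments of [h] telescope, and each segment contributes at most its
    length. *)
Lemma pot_le_dist (h : point G -> R) :
  (forall e s t, 0 <= s <= len e -> 0 <= t <= len e ->
    h (at_edge e s) - h (at_edge e t) <= `|s - t|) ->
  forall x y, h x - h y <= dist x y.
Proof.
move=> H x y; apply: le_dist => p.
elim: p x => [x /= ->|s p IH x /= [[v1 v2] -> /IH hp]].
  by rewrite subrr path_length_ge0.
have := H _ _ _ v1 v2.
by rewrite /path_length big_cons -/(path_length p) distrC; lra.
Qed.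

Definition to_end e t : R := Num.min t (len e - t).

Lemma to_end0 e : to_end e 0 = 0.
Proof. by rewrite /to_end subr0 min_l// len_ge0. Qed.

Lemma to_end_len e : to_end e (len e) = 0.
Proof. by rewrite /to_end subrr min_r// len_ge0. Qed.

Lemma to_end_lip e s t : to_end e s - to_end e t <= `|s - t|.
Proof.
have := ler_norm (s - t); have := ler_norm (t - s); rewrite (distrC t s).
by rewrite /to_end /Num.min; case: (ltP s) => ?; case: (ltP t) => ? ? ?; lra.
Qed.

Lemma circ_lip c r s t : `|r - s| <= c -> `|r - t| <= c ->
  circle_dist c r s - circle_dist c r t <= `|s - t|.
Proof.
rewrite /circle_dist.
have := ler_norm (s - t); have := ler_norm (t - s); rewrite (distrC t s).
move: `|s - t| => n h1 h2 h3 h4.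
have := ler_norm (r - s); have := ler_norm (s - r); rewrite (distrC s r).
have := ler_norm (r - t); have := ler_norm (t - r); rewrite (distrC t r).
have := ler_dist_dist (r - s) (r - t).
rewrite (_ : r - s - (r - t) = t - s); last by ring.
move: h3 h4.
move: `|r - s| `|r - t| => a b h3 h4.
move: (ler_norm (t - s)) => h5.
have : `|t - s| <= n by rewrite ler_norml; apply/andP; split; lra.
move=> h6 + ? ? ? ?; rewrite ler_norml => /andP[h7 h8].
rewrite /Num.min; case: (ltP a) => ?; case: (ltP b) => ?; lra.
Qed.

(** The potential is [to_end] on [e], its opposite on [f] and 0 elsewhere; it vanishes at every
    vertex, hence is well defined. *)
Lemma le_dist_diff_edges e f s t : e != f -> 0 <= s <= len e -> 0 <= t <= len f ->
  to_end e s + to_end f t <= dist (at_edge e s) (at_edge f t).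
Proof.
move=> ef hs ht.
pose he g r : R := if g == e then to_end e r else
  if g == f then - to_end f r else 0.
pose h := pot (fun=> 0) he.
have hE g r : 0 <= r <= len g -> h (at_edge g r) = he g r.
  apply: pot_at_edge; rewrite /he.
    by case: ifP => _; [|case: ifP => _]; rewrite // to_end0 ?oppr0.
  by case: eqP => [->|_]; [|case: eqP => [->|//]]; rewrite to_end_len ?oppr0.
have -> : to_end e s + to_end f t = h (at_edge e s) - h (at_edge f t).
  by rewrite !hE// /he eqxx eq_sym (negPf ef) eqxx opprK.
apply: pot_le_dist => g a b ha hb; rewrite !hE// /he.
case: eqP => _; first exact: to_end_lip.
case: eqP => _; last by rewrite subrr.
by rewrite opprK addrC distrC; exact: to_end_lip.
Qed.

Lemma circle_dist0 c s : 0 <= s <= c -> circle_dist c s 0 = circle_dist c s c.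
Proof.
move=> /andP[s0 sc]; rewrite /circle_dist subr0 ger0_norm// distrC ger0_norm ?subr_ge0//.
by rewrite opprB addrCA subrr addr0 minC.
Qed.

Lemma circle_distss c s : 0 <= c -> circle_dist c s s = 0.
Proof. by move=> c0; rewrite /circle_dist subrr normr0 subr0 min_l. Qed.

(** The circle distance from [s] takes the same value at both ends of [e], so it extends by that
    constant to the rest of the graph. *)
Lemma le_dist_same_edge e s t : 0 <= s <= len e -> 0 <= t <= len e ->
  circle_dist (len e) s t <= dist (at_edge e s) (at_edge e t).
Proof.
move=> hs ht; set c := circle_dist (len e) s.
pose he g r : R := if g == e then c r else c 0.
pose h := pot (fun=> c 0) he.
have hE g r : 0 <= r <= len g -> h (at_edge g r) = he g r.
  apply: pot_at_edge; rewrite /he; first by case: ifP.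
  case: eqP => [->|//].
  by rewrite /c -circle_dist0.
have inle (a b : R) : 0 <= a <= len e -> 0 <= b <= len e -> `|a - b| <= len e.
  by move=> /andP[? ?] /andP[? ?]; rewrite ler_norml; apply/andP; split; lra.
have -> : c t = h (at_edge e t) - h (at_edge e s).
  by rewrite !hE// /he eqxx /c circle_distss ?len_ge0 ?subr0.
rewrite dist_sym; apply: pot_le_dist => g a b ha hb; rewrite !hE// /he.
case: eqP => [ge|_]; last by rewrite subrr.
by move: ha hb; rewrite ge => ha hb; apply: circ_lip; exact: inle.
Qed.

Lemma len_lbound : exists2 m, 0 < m & forall e, m <= len e.
Proof.
(* The default value 1 keeps the minimum positive when there are no edges. *)
exists (\big[Order.min/1]_(e : edge G) len e).
  by elim/big_ind: _ => // [a b ? ?|e _]; [rewrite lt_min; apply/andP|exact: len_gt0].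
by move=> e; exact: bigmin_le_cond.
Qed.

(** The potential is a bump of height [m] and slope 1 around [v]. No edge is shorter than [m], so
    the bump vanishes at all other vertices; the maximum in [he] handles loops at [v], which carry
    it from both ends. *)
Lemma dist_vertex_gt0 v w : v != w -> 0 < dist (inl v : point G) (inl w).
Proof.
move=> vw; have [m m0 mle] := len_lbound.
pose b (c : bool) r := if c then Num.max 0 (m - r) else 0.
pose he e r := Num.max (b (org e == v) r) (b (dst e == v) (len e - r)).
pose hv u : R := if u == v then m else 0.
have b0 c r : m <= r -> b c r = 0.
  by move=> mr; rewrite /b; case: c => //; rewrite max_l//; lra.
have bm c : b c 0 = if c then m else 0.
  by rewrite /b; case: c => //; rewrite subr0 max_r// ltW.
have hE e r : 0 <= r <= len e -> pot hv he (at_edge e r) = he e r.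
  apply: pot_at_edge; rewrite /he /hv.
    by rewrite subr0 bm (b0 _ (len e))//; case: ifP => _; rewrite max_l// ltW.
  by rewrite subrr bm (b0 _ (len e))//; case: ifP => _; rewrite max_r// ltW.
apply: lt_le_trans m0 _.
have -> : m = pot hv he (inl v) - pot hv he (inl w).
  by rewrite /= /hv eqxx eq_sym (negPf vw) subr0.
have bl c r s : b c r - b c s <= `|r - s|.
  have := ler_norm (r - s); have := ler_norm (s - r); rewrite (distrC s r).
  rewrite /b; case: c => ? ?; last by rewrite subrr.
  by rewrite /Num.max; case: (ltP 0) => ?; case: (ltP 0) => ?; lra.
apply: pot_le_dist => e s t hs ht; rewrite !hE// /he.
have := bl (org e == v) s t; have := bl (dst e == v) (len e - s) (len e - t).
rewrite (_ : len e - s - (len e - t) = t - s); last by ring.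
rewrite (distrC t s); move: (b _ s) (b _ t) (b _ (_ - s)) (b _ (_ - t)) => a a' c c'.
by rewrite /Num.max; case: (ltP a) => ?; case: (ltP a') => ? ? ?; lra.
Qed.

End Distance.

(** * Integrals of the distance functions of an interval and of a circle *)

Section ExplicitIntegrals.
Variable R : realType.
Implicit Types (a b c l s t : R).

Lemma lip_affine a b c d : lip a b (fun t => c * t + d).
Proof. by apply: lipD; [apply: lipZ; exact: lip_id|exact: lip_cst]. Qed.

Lemma itg_affine a b c d : a <= b ->
  itg a b (fun t => c * t + d) = c * ((b ^+ 2 - a ^+ 2) / 2) + d * (b - a).
Proof.
move=> ab; rewrite itgD; [|by apply: lipZ; exact: lip_id|exact: lip_cst].
by rewrite itgZ; [rewrite itg_id// itg_cst|exact: lip_id].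
Qed.

Lemma lip_dist_pt a b s : lip a b (fun t => `|s - t|).
Proof. by apply/lip_abs/lipD; [exact: lip_cst|exact/lipN/lip_id]. Qed.

Lemma itg_dist_pt l s : 0 <= s <= l ->
  itg 0 l (fun t => `|s - t|) = (s ^+ 2 + (l - s) ^+ 2) / 2.
Proof.
move=> /andP[s0 sl]; rewrite (itg_split s0 sl); last exact: lip_dist_pt.
rewrite (@eq_itg _ 0 s _ (fun t => (-1) * t + s)); last first.
  by move=> t /andP[? ?]; rewrite ger0_norm; lra.
rewrite (@eq_itg _ s l _ (fun t => 1 * t + - s)); last first.
  by move=> t /andP[? ?]; rewrite ler0_norm; lra.
by rewrite !itg_affine//; field.
Qed.

Lemma lip_to_end a b l : lip a b (fun t => Num.min t (l - t)).
Proof.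
by apply: lip_min; [exact: lip_id|apply: lipD; [exact: lip_cst|exact/lipN/lip_id]].
Qed.

Lemma itg_to_end l : 0 <= l ->
  itg 0 l (fun t => Num.min t (l - t)) = l ^+ 2 / 4.
Proof.
move=> l0; have h1 : 0 <= l / 2 by lra.
have h2 : l / 2 <= l by lra.
rewrite (itg_split h1 h2); last exact: lip_to_end.
rewrite (@eq_itg _ 0 (l / 2) _ (fun t => 1 * t + 0)); last first.
  by move=> t /andP[? ?]; rewrite min_l; lra.
rewrite (@eq_itg _ (l / 2) l _ (fun t => (-1) * t + l)); last first.
  by move=> t /andP[? ?]; rewrite min_r; lra.
by rewrite !itg_affine//; field.
Qed.

Lemma lip_circ a b c s : lip a b (circle_dist c s).
Proof.
apply: lip_min; first exact: lip_dist_pt.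
by apply: lipD; [exact: lip_cst|exact/lipN/lip_dist_pt].
Qed.

Lemma circle_dist_rev c s t : circle_dist c (c - s) (c - t) = circle_dist c s t.
Proof.
by rewrite /circle_dist (_ : c - s - (c - t) = t - s) 1?distrC//; ring.
Qed.

(** For [u] in the first half, the integrand is affine between the breaks at [u] and at its antipode
    [u + c / 2]. The second half follows by reflection. *)
Lemma itg_circ c s : 0 <= s <= c -> itg 0 c (circle_dist c s) = c ^+ 2 / 4.
Proof.
have half u : 0 <= u -> u <= c / 2 -> itg 0 c (circle_dist c u) = c ^+ 2 / 4.
  move=> u0 uc; have uc' : u <= c by lra.
  have uh : u <= u + c / 2 by lra.
  have uh' : u + c / 2 <= c by lra.
  rewrite (itg_split u0 uc'); last exact: lip_circ.
  rewrite (itg_split uh uh'); last exact: lip_circ.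
  rewrite (@eq_itg _ 0 u _ (fun t => (-1) * t + u)); last first.
    move=> t /andP[? ?]; rewrite /circle_dist ger0_norm ?subr_ge0//.
    by rewrite min_l; lra.
  rewrite (@eq_itg _ u (u + c / 2) _ (fun t => 1 * t + - u)); last first.
    move=> t /andP[? ?]; rewrite /circle_dist ler0_norm ?subr_le0//.
    by rewrite min_l; lra.
  rewrite (@eq_itg _ (u + c / 2) c _ (fun t => (-1) * t + (c + u))); last first.
    move=> t /andP[? ?]; rewrite /circle_dist ler0_norm; last by lra.
    by rewrite min_r; lra.
  by rewrite !itg_affine//; field.
move=> /andP[s0 sc]; case: (leP s (c / 2)) => h; first exact: half.
rewrite -(@itg_rev _ c _ (le_trans s0 sc)); last exact: lip_circ.
rewrite (@eq_itg _ 0 c _ (circle_dist c (c - s))); last first.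
  by move=> t _; rewrite -(circle_dist_rev c (c - s)) subKr.
by apply: half; lra.
Qed.

(** Every point of a circle lies on a half circle joining [s] to its antipode; the conditional picks
    the representative of the antipode in [[0, c[]. *)
Lemma circle_dist_antipode c s t : 0 <= s < c -> 0 <= t < c ->
  circle_dist c s t +
  circle_dist c t (if s < c / 2 then s + c / 2 else s - c / 2) = c / 2.
Proof.
move=> /andP[s0 sc] /andP[t0 tc]; rewrite /circle_dist.
have norm2 (u : R) : (0 <= u /\ `|u| = u) \/ (u < 0 /\ `|u| = - u).
  by case: (ger0P u) => h; [left|right].
case: (ltP s (c / 2)) => h.
  case: (norm2 (s - t)) => -[? ->]; case: (norm2 (t - (s + c / 2))) => -[? ->];
    rewrite /Num.min; case: ltP => ?; case: ltP => ?; lra.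
case: (norm2 (s - t)) => -[? ->]; case: (norm2 (t - (s - c / 2))) => -[? ->];
  rewrite /Num.min; case: ltP => ?; case: ltP => ?; lra.
Qed.

End ExplicitIntegrals.

(** * Integration over a metric graph *)

Section GraphIntegral.
Variables (R : realType) (G : metric_graph R).
Implicit Types (x y z : point G) (e f : edge G) (S : seq (edge G)).
Implicit Types (d : edge G * bool) (g h : point G -> R) (a b c s t : R).

Definition glip g : Prop := exists2 K : R, 0 <= K &
  forall e s t, 0 <= s <= len e -> 0 <= t <= len e ->
    `|g (at_edge e s) - g (at_edge e t)| <= K * `|s - t|.

Definition eint e g : R := itg 0 (len e) (g \o at_edge e).
(** Indexed by a list of edges, so that it also applies to the subgraphs built edge by edge or ear
    by ear later on. *)
Definition gint S g : R := \sum_(e <- S) eint e g.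
Definition tlen S : R := \sum_(e <- S) len e.

Lemma glip_lip g e : glip g -> lip 0 (len e) (g \o at_edge e).
Proof. by move=> [K K0 H]; exists K => // s t; exact: H. Qed.

Lemma glip_dist_lip g K : 0 <= K -> (forall x y, g x - g y <= K * dist x y) ->
  glip g.
Proof.
move=> K0 H; exists K => // e s t hs ht.
have h1 : K * dist (at_edge e s) (at_edge e t) <= K * `|s - t|.
  by rewrite ler_wpM2l// dist_edge.
have := H (at_edge e s) (at_edge e t); have := H (at_edge e t) (at_edge e s).
by rewrite (dist_sym (at_edge e t)) ler_norml => *; apply/andP; split; lra.
Qed.

Lemma glip_dist x : glip (dist x).
Proof.
apply: (@glip_dist_lip _ 1) => // y z; rewrite mul1r.
by have := dist_tri z x y; rewrite (dist_sym z); lra.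
Qed.

Lemma glip_cst c : glip (fun=> c).
Proof. by exists 0 => // *; rewrite subrr normr0 mul0r. Qed.

Lemma glipD g h : glip g -> glip h -> glip (fun x => g x + h x).
Proof.
move=> [K K0 H] [K' K'0 H']; exists (K + K'); first exact: addr_ge0.
move=> e s t hs ht; rewrite opprD addrACA mulrDl.
by apply: le_trans (ler_normD _ _) (lerD _ _); [exact: H|exact: H'].
Qed.

Lemma glipZ c g : glip g -> glip (fun x => c * g x).
Proof.
move=> [K K0 H]; exists (`|c| * K); first exact: mulr_ge0.
by move=> e s t hs ht; rewrite -mulrBr normrM -mulrA ler_wpM2l// H.
Qed.

Lemma eint_le e g h : glip g -> glip h ->
  (forall t, 0 <= t <= len e -> g (at_edge e t) <= h (at_edge e t)) ->
  eint e g <= eint e h.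
Proof. by move=> lg lh H; apply: itg_le => //; exact: glip_lip. Qed.

Lemma gint_le S g h : glip g -> glip h ->
  (forall e t, e \in S -> 0 <= t <= len e -> g (at_edge e t) <= h (at_edge e t)) ->
  gint S g <= gint S h.
Proof.
move=> lg lh H; rewrite /gint big_seq [leRHS]big_seq; apply: ler_sum => e eS.
by apply: eint_le => // t; exact: H.
Qed.

Lemma gint_cst S c : gint S (fun=> c) = c * tlen S.
Proof.
rewrite /gint /tlen big_distrr/=; apply: eq_bigr => e _.
by rewrite /eint /comp itg_cst ?len_ge0// subr0.
Qed.

Lemma gintD S g h : glip g -> glip h ->
  gint S (fun x => g x + h x) = gint S g + gint S h.
Proof.
move=> lg lh; rewrite /gint -big_split; apply: eq_bigr => e _.
by rewrite /= /eint -itgD//; exact: glip_lip.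
Qed.

Lemma gintZ S c g : glip g -> gint S (fun x => c * g x) = c * gint S g.
Proof.
move=> lg; rewrite /gint big_distrr; apply: eq_bigr => e _ /=.
by rewrite /eint -itgZ//; exact: glip_lip.
Qed.

Lemma gint_cons e S g : gint (e :: S) g = eint e g + gint S g.
Proof. by rewrite /gint big_cons. Qed.

Lemma tlen_cons e S : tlen (e :: S) = len e + tlen S.
Proof. by rewrite /tlen big_cons. Qed.

Lemma tlen_ge0 S : 0 <= tlen S.
Proof. by rewrite /tlen sumr_ge0// => e _; exact: len_ge0. Qed.

Lemma gint_perm S S' g : perm_eq S S' -> gint S g = gint S' g.
Proof. exact: perm_big. Qed.

Lemma tlen_perm S S' : perm_eq S S' -> tlen S = tlen S'.
Proof. exact: perm_big. Qed.

(** Each edge has a nonnegative defect, so no defect can be compensated by another one, and [itg_eq]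
    applies edge by edge. *)
Lemma gint_eq S g h : glip g -> glip h ->
  (forall e t, e \in S -> 0 <= t <= len e -> g (at_edge e t) <= h (at_edge e t)) ->
  gint S h <= gint S g ->
  forall e t, e \in S -> 0 <= t <= len e -> g (at_edge e t) = h (at_edge e t).
Proof.
move=> lg lh; elim: S => [//|f S IH] H; rewrite !gint_cons => le e t.
have h1 : gint S g <= gint S h.
  by apply: gint_le => // e' t' e'S; apply: H; rewrite inE e'S orbT.
have h2 : eint f g <= eint f h.
  by apply: eint_le => // t'; apply: H; rewrite mem_head.
rewrite inE => /predU1P[->|eS].
- apply: (@itg_eq _ 0 (len f) (g \o at_edge f) (h \o at_edge f)).
  + exact: len_gt0.
  + exact: glip_lip.
  + exact: glip_lip.
  + by move=> t'; apply: H; rewrite mem_head.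
  + by rewrite -/(eint f g) -/(eint f h); lra.
- by apply: IH => //; [move=> e' t' e'S; apply: H; rewrite inE e'S orbT|lra].
Qed.

(** By the triangle inequality, moving the base point changes the integrand everywhere by at most
    the displacement. This makes the outer integrals legitimate. *)
Lemma glip_gint S : glip (fun x => gint S (dist x)).
Proof.
apply: (@glip_dist_lip _ (tlen S)) => [|x y]; first exact: tlen_ge0.
rewrite mulrC -gint_cst lerBlDr -gintD; [|exact: glip_cst|exact: glip_dist].
apply: gint_le; [exact: glip_dist|apply: glipD; [exact: glip_cst|exact: glip_dist]|].
by move=> e t _ _; exact: dist_tri.
Qed.

Lemma graph_integralE g : glip g -> graph_integral g = gint (enum (edge G)) g.
Proof.
move=> lg; rewrite /graph_integral /gint big_enum/=; apply: eq_bigr => e _.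
by rewrite /eint -itg_open//; exact: glip_lip.
Qed.

Lemma total_lengthE : total_length G = tlen (enum (edge G)).
Proof. by rewrite /total_length /tlen big_enum. Qed.

Lemma mean_distanceE : mean_distance G = ((total_length G) ^+ 2)^-1 *
  gint (enum (edge G)) (fun x => gint (enum (edge G)) (dist x)).
Proof.
have inner : (fun x : point G => graph_integral (fun y => dist x y)) =
    fun x => gint (enum (edge G)) (dist x).
  by apply/funext => x; rewrite graph_integralE//; exact: glip_dist.
by rewrite /mean_distance inner (graph_integralE (glip_gint _)).
Qed.

(* A dart [(e, b)] is the edge [e] travelled from [org e] if [b], and from
   [dst e] otherwise. *)
Definition dpt d s : point G := at_edge d.1 (if d.2 then s else len d.1 - s).
Definition dsrc d := if d.2 then org d.1 else dst d.1.
Definition dtgt d := if d.2 then dst d.1 else org d.1.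

Lemma dpt0 d : dpt d 0 = inl (dsrc d).
Proof.
by case: d => e [] /=; rewrite /dpt /dsrc /= ?at_edge0// subr0 at_edge_len.
Qed.

Lemma dpt_len d : dpt d (len d.1) = inl (dtgt d).
Proof.
by case: d => e [] /=; rewrite /dpt /dtgt /= ?at_edge_len// subrr at_edge0.
Qed.

Lemma dist_dpt d s t : 0 <= s <= len d.1 -> 0 <= t <= len d.1 ->
  dist (dpt d s) (dpt d t) <= `|s - t|.
Proof.
case: d => e [] /= hs ht; rewrite /dpt /=; first exact: dist_edge.
move: hs ht => /andP[? ?] /andP[? ?].
apply: le_trans (dist_edge _ _) _; try by apply/andP; split; lra.
by rewrite (_ : len e - s - (len e - t) = t - s) 1?distrC//; ring.
Qed.

Lemma at_edge_dpt d t : at_edge d.1 t = dpt d (if d.2 then t else len d.1 - t).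
Proof. by case: d => e []; rewrite /dpt/= ?subKr. Qed.

Lemma glip_dpt g d : glip g -> lip 0 (len d.1) (g \o dpt d).
Proof.
move=> lg; case: d => e [] /=; first exact: glip_lip.
apply: (lip_comp (glip_lip e lg) (psi := fun s => len e - s)).
  by apply: lipD; [exact: lip_cst|exact/lipN/lip_id].
by move=> t /andP[? ?]; apply/andP; split; lra.
Qed.

Lemma eint_dpt g d : glip g -> eint d.1 g = itg 0 (len d.1) (g \o dpt d).
Proof.
move=> lg; case: d => e [] //=.
rewrite /eint -(@itg_rev _ (len e)) //; [exact: len_ge0|exact: glip_lip].
Qed.

End GraphIntegral.

(** * The lower bound *)

Section LowerBound.
Variables (R : realType) (G : metric_graph R).
Implicit Types (x y z : point G) (e f : edge G) (s t : R) (v w : vertex G).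

Local Notation EE := (enum (edge G)).
Local Notation L := (total_length G).
Local Notation W := (gint EE (fun x => gint EE (dist x))).
Local Notation n := (#|edge G|%:R : R).
Local Notation Q := (\sum_(e : edge G) len e ^+ 2).
Local Notation C := (\sum_(e : edge G) len e ^+ 3).

Lemma lip_to_end_edge a b e : lip a b (@to_end R G e).
Proof. exact: lip_to_end. Qed.

Lemma itg_to_end_edge e : itg 0 (len e) (to_end e) = len e ^+ 2 / 4.
Proof. exact/itg_to_end/len_ge0. Qed.

(* The integral over the second point of the lower bounds [le_dist_same_edge]
   and [le_dist_diff_edges] (see [sum_lower_inner]). *)
Definition lower_inner e s : R := (L - len e) * to_end e s + Q / 4.

Lemma sum_lower_inner e s :
  \sum_(f : edge G)
     (if f == e then len e ^+ 2 / 4 else len f * to_end e s + len f ^+ 2 / 4) =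
  lower_inner e s.
Proof.
rewrite (bigD1 e)//= eqxx.
rewrite (eq_bigr (fun f => len f * to_end e s + len f ^+ 2 / 4)); last first.
  by move=> f /negPf ->.
rewrite big_split/= -!mulr_suml /lower_inner /total_length.
rewrite [\sum_(e : edge G) len e](bigD1 e)//= [\sum_(e : edge G) _ ^+ 2](bigD1 e)//=.
by field.
Qed.

Lemma lip_to_end_shift e f s :
  lip 0 (len f) (fun t => to_end e s + to_end f t).
Proof. by apply: lipD; [exact: lip_cst|exact: lip_to_end_edge]. Qed.

Lemma itg_to_end_shift e f s :
  itg 0 (len f) (fun t => to_end e s + to_end f t) =
  len f * to_end e s + len f ^+ 2 / 4.
Proof.
rewrite itgD; [|exact: lip_cst|exact: lip_to_end_edge].
by rewrite itg_cst ?len_ge0// itg_to_end_edge subr0 mulrC.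
Qed.

Lemma lower_inner_le e s : 0 <= s <= len e ->
  lower_inner e s <= gint EE (dist (at_edge e s)).
Proof.
move=> hs; rewrite -sum_lower_inner /gint big_enum/=; apply: ler_sum => f _.
have lf := glip_lip f (glip_dist (at_edge e s)).
case: eqP => [->|/eqP fe].
  rewrite -(itg_circ hs); apply: itg_le; [exact: lip_circ|exact: glip_lip (glip_dist _)|].
  by move=> t ht; exact: le_dist_same_edge.
rewrite -itg_to_end_shift; apply: itg_le; [exact: lip_to_end_shift|exact: lf|].
by move=> t ht; apply: le_dist_diff_edges => //; rewrite eq_sym.
Qed.

Lemma lip_lower_inner e : lip 0 (len e) (lower_inner e).
Proof. by apply: lipD; [apply: lipZ; exact: lip_to_end_edge|exact: lip_cst]. Qed.

Lemma itg_lower_inner e : itg 0 (len e) (lower_inner e) =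
  (L - len e) * (len e ^+ 2 / 4) + Q / 4 * len e.
Proof.
rewrite itgD; [|by apply: lipZ; exact: lip_to_end_edge|exact: lip_cst].
by rewrite itgZ ?itg_to_end_edge ?itg_cst ?subr0 ?len_ge0//; exact: lip_to_end_edge.
Qed.

Lemma sum_itg_lower_inner :
  \sum_(e : edge G) itg 0 (len e) (lower_inner e) = L * Q / 2 - C / 4.
Proof.
rewrite (eq_bigr (fun e => L / 4 * len e ^+ 2 + - (1 / 4) * len e ^+ 3 + Q / 4 * len e)).
  by rewrite !big_split/= -!mulr_sumr -/(total_length G); field.
by move=> e _; rewrite itg_lower_inner; field.
Qed.

Lemma W_ge : L * Q / 2 - C / 4 <= W.
Proof.
rewrite -sum_itg_lower_inner /gint big_enum/=; apply: ler_sum => e _.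
apply: itg_le; [exact: lip_lower_inner|exact: glip_lip (glip_gint _)|].
by move=> t ht; exact: lower_inner_le.
Qed.

(** Equality of the double integrals forces equality of the inner ones at every point, in particular
    at the vertex [org e]. There the lower bound of the distance is [to_end], so the distance from
    [org e] equals [to_end] everywhere, and this vanishes at vertices. *)
Lemma W_min_vertices : W <= L * Q / 2 - C / 4 ->
  forall e f, dist (inl (org e) : point G) (inl (org f)) = 0 /\
              dist (inl (org e) : point G) (inl (dst f)) = 0.
Proof.
move=> Wle e f.
have inner_le : gint EE (dist (inl (org e) : point G)) <= Q / 4.
  have : lower_inner e 0 = gint EE (dist (at_edge e 0)).
    apply: (@itg_eq _ 0 (len e) (lower_inner e)
      ((fun x => gint EE (dist x)) \o at_edge e)) => //.
    - exact: len_gt0.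
    - exact: lip_lower_inner.
    - exact: glip_lip (glip_gint _).
    - by move=> t ht; exact: lower_inner_le.
    - move: Wle; rewrite -sum_itg_lower_inner /gint big_enum/=.
      rewrite (bigD1 e)//= [leRHS](bigD1 e)//= -/(gint _ _).
      (* The other edges have defects of the same sign, so they cannot hide one on [e]. *)
      have : \sum_(i | i != e) itg 0 (len i) (lower_inner i) <=
             \sum_(i | i != e) eint i (fun x => \sum_(e <- EE) eint e (dist x)).
        apply: ler_sum => i _.
        apply: itg_le; [exact: lip_lower_inner|exact: glip_lip (glip_gint _)|].
        by move=> t ht; exact: lower_inner_le.
      by rewrite /eint /gint; lra.
    - exact: in0l.
  by rewrite /lower_inner to_end0 mulr0 add0r at_edge0 => ->.
pose h : point G -> R := pot (fun=> 0) (fun e => to_end e).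
have hE g t : 0 <= t <= len g -> h (at_edge g t) = to_end g t.
  by apply: pot_at_edge; rewrite ?to_end0 ?to_end_len.
have lh : glip h.
  exists 1 => // g a b ha hb; rewrite !hE// mul1r ler_norml.
  have := to_end_lip g a b; have := to_end_lip g b a; rewrite (distrC b a).
  by move=> ? ?; apply/andP; split; lra.
have hint : gint EE h = Q / 4.
  rewrite /gint big_enum/= mulr_suml; apply: eq_bigr => g _.
  by rewrite -itg_to_end_edge; apply: eq_itg => t /hE.
have key t : 0 <= t <= len f -> h (at_edge f t) = dist (inl (org e)) (at_edge f t).
  apply: (@gint_eq _ _ EE h (dist (inl (org e))) lh (glip_dist _)).
  - move=> g a _ ha; rewrite hE// -at_edge0.
    case: (eqVneq e g) => [eg|eg].
      rewrite -eg in ha *; apply: le_trans (le_dist_same_edge (in0l e) ha).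
      by rewrite /circle_dist sub0r normrN ger0_norm//; case/andP: ha.
    apply: le_trans (le_dist_diff_edges eg (in0l e) ha).
    by rewrite to_end0 add0r.
  - by rewrite hint.
  - by rewrite mem_enum.
have := key _ (in0l f); have := key _ (inll f).
by rewrite !hE ?in0l ?inll// to_end0 to_end_len at_edge0 at_edge_len => <- <-.
Qed.


(** All ends of edges being the same point, explicit routes through it attain both lower bounds on
    the distance. *)
Lemma W_one_vertex : (forall v w, v = w) -> W = L * Q / 2 - C / 4.
Proof.
move=> vw; apply/eqP; rewrite eq_le W_ge andbT.
have dend e s : 0 <= s <= len e -> forall v, dist (at_edge e s) (inl v) <= to_end e s.
  move=> hs v; rewrite /to_end /Num.min; case: ifP => _.
    rewrite (vw v (org e)) -at_edge0; apply: le_trans (dist_edge hs (in0l e)) _.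
    by rewrite subr0 ger0_norm//; case/andP: hs.
  rewrite (vw v (dst e)) -at_edge_len; apply: le_trans (dist_edge hs (inll e)) _.
  by rewrite distrC ger0_norm// subr_ge0; case/andP: hs.
rewrite -sum_itg_lower_inner /gint big_enum/=; apply: ler_sum => e _.
apply: itg_le; [exact: glip_lip (glip_gint _)|exact: lip_lower_inner|].
move=> s hs /=; rewrite -sum_lower_inner big_enum/=; apply: ler_sum => f _.
have lf := glip_lip f (glip_dist (at_edge e s)).
case: eqP => [->|_]; last first.
  rewrite -itg_to_end_shift; apply: itg_le; [exact: lf|exact: lip_to_end_shift|].
  move=> t ht; apply: le_trans (dist_tri (inl (org e)) _ _) _.
  by apply: lerD; [exact: dend|rewrite dist_sym; exact: dend].
rewrite -(itg_circ hs); apply: itg_le; [exact: glip_lip (glip_dist _)|exact: lip_circ|].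
move=> t ht /=; rewrite /circle_dist le_min dist_edge//=.
wlog st : s t hs ht {lf} / s <= t.
  move=> H; case: (leP s t) => [st|/ltW ts]; first exact: H.
  by rewrite dist_sym distrC; exact: H.
(* Around the loop the other way: from [s] down to 0, which is the same vertex as [len e], and from
   there down to [t]. *)
apply: le_trans (dist_tri (inl (org e)) _ _) _.
rewrite -{1}at_edge0 (vw (org e) (dst e)) -at_edge_len.
apply: le_trans (lerD (dist_edge hs (in0l e)) (dist_edge (inll e) ht)) _.
case/andP: hs => s0 sl; case/andP: ht => t0 tl.
by rewrite subr0 [`|s - t|]distrC !ger0_norm; lra.
Qed.

Lemma edge_exists : 0 < L -> exists e : edge G, true.
Proof.
move=> L0; case: (pickP (@predT (edge G))) => [e _|no]; first by exists e.
by move: L0; rewrite /total_length big_pred0 ?ltxx// => e; have := no e.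
Qed.

Lemma edge_count_gt0 : 0 < L -> 0 < n.
Proof. by move=> /edge_exists[e _]; rewrite ltr0n; apply/card_gt0P; exists e. Qed.

(** For [F x = L * x ^+ 2 / 2 - x ^+ 3 / 4], the summand is [F] minus its tangent at the mean length
    [a]. The linear parts of the tangents cancel because the deviations from [a] add up to 0, and
    [n * F a] is the claimed bound. *)
Lemma tangent_sum : 0 < L -> let a := L / n in
  L * Q / 2 - C / 4 - (2 * n - 1) / (4 * n ^+ 2) * L ^+ 3 =
  \sum_(e : edge G) (len e - a) ^+ 2 * (L / 2 - (len e + 2 * a) / 4).
Proof.
move=> L0 a; have n0 := edge_count_gt0 L0; have aE : a = L / n by [].
(* [k] is the constant coefficient of the summand as a polynomial in [len e]; the existential keeps
   it folded during the summation. *)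
have [k kE] : exists k, k = L * a ^+ 2 / 2 - a ^+ 3 / 2 by eexists.
rewrite [RHS](eq_bigr (fun e => L / 2 * len e ^+ 2 + - (1 / 4) * len e ^+ 3 +
  (3 / 4 * a ^+ 2 - L * a) * len e + k)); last first.
  by move=> e _; rewrite kE; field.
rewrite !big_split/= -!mulr_sumr -/(total_length G).
have -> : \sum_(e : edge G) k = k * n by rewrite sumr_const mulr_natr.
by rewrite kE aE; field; lra.
Qed.

(** With a single edge the square is 0. Otherwise [len e < L] and the mean length is at most
    [L / 2], which makes the second factor positive. *)
Lemma tangent_term_ge0 e : 0 < L ->
  0 <= (len e - L / n) ^+ 2 * (L / 2 - (len e + 2 * (L / n)) / 4) /\
  ((len e - L / n) ^+ 2 * (L / 2 - (len e + 2 * (L / n)) / 4) = 0 ->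
   len e = L / n).
Proof.
move=> L0; have n0 := edge_count_gt0 L0.
case: (pickP [pred f | f != e]) => [f /= fe|no]; last first.
  have n1 : n = 1.
    rewrite (_ : #|edge G| = 1)%N//; apply/eqP/fintype1P; exists e => f.
    by apply/eqP; have /= /negbFE := no f.
  have -> : L = len e.
    by rewrite /total_length (bigD1 e)//= big_pred0 ?addr0.
  by rewrite n1 divr1 subrr expr0n/= mul0r.
have lt : len e < L.
  rewrite /total_length (bigD1 e)//= ltrDl (bigD1 f)//=.
  by rewrite ltr_pwDl ?len_gt0// sumr_ge0// => g _; exact: len_ge0.
have n2 : 2 <= n.
  by rewrite (ler_nat _ 2); apply/card_gt1P; exists f, e.
have a2 : L / n <= L / 2.
  by rewrite ler_pdivrMr// mulrAC ler_pdivlMr//; nra.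
split; first by apply: mulr_ge0; [exact: sqr_ge0|lra].
move=> /eqP; rewrite mulf_eq0 sqrf_eq0 subr_eq0 => /orP[/eqP//|/eqP h].
by exfalso; lra.
Qed.

Lemma mean_distance_lower : 0 < L ->
  (2 * n - 1) / (4 * n ^+ 2) * L <= mean_distance G /\
  (mean_distance G = (2 * n - 1) / (4 * n ^+ 2) * L <-> equilateral_flower G).
Proof.
move=> L0; have n0 := edge_count_gt0 L0.
have L2 : 0 < L ^+ 2 by rewrite exprn_gt0.
have tg : 0 <= L * Q / 2 - C / 4 - (2 * n - 1) / (4 * n ^+ 2) * L ^+ 3.
  by rewrite tangent_sum// sumr_ge0// => e _; case: (tangent_term_ge0 e L0).
have mE : W = L ^+ 2 * mean_distance G.
  by rewrite mean_distanceE mulrA divff ?mul1r// lt0r_neq0.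
have bE : L ^+ 2 * ((2 * n - 1) / (4 * n ^+ 2) * L) =
  (2 * n - 1) / (4 * n ^+ 2) * L ^+ 3 by field; lra.
have Wge := W_ge; split.
  by rewrite -(ler_pM2l L2) bE -mE; lra.
split=> [mean_eq|[/fintype1[v0 v0E] loops len_eq]].
  have Weq : W = (2 * n - 1) / (4 * n ^+ 2) * L ^+ 3 by rewrite mE mean_eq bE.
  have /W_min_vertices dv : W <= L * Q / 2 - C / 4 by lra.
  have same e f : org e = org f /\ org e = dst f.
    have [h1 h2] := dv e f; split; apply/eqP; apply: contraT => /(dist_vertex_gt0 (G := G)).
      by rewrite h1 ltxx.
    by rewrite h2 ltxx.
  have [e0 _] := edge_exists L0.
  (* [W] equals the tangent bound while [W_ge] puts the sum of the cubics in between, so the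
     nonnegative tangent terms add up to 0. *)
  have tsum : \sum_(e : edge G)
    (len e - L / n) ^+ 2 * (L / 2 - (len e + 2 * (L / n)) / 4) = 0.
    by rewrite -tangent_sum//; lra.
  have lenE e : len e = L / n.
    have [_] := tangent_term_ge0 e L0; apply; apply/eqP.
    have := psumr_eq0P (fun i _ => (tangent_term_ge0 i L0).1) tsum.
    by move=> /(_ e isT)/eqP.
  split; last by move=> e f; rewrite !lenE.
    (* A vertex reached by a nonempty walk is an end of its last edge, and all ends of edges
       coincide with [org e0]. *)
    apply/eqP/fintype1P; exists (org e0) => v.
    case/connectP: (graph_connected (org e0) v) => p.
    elim/last_ind: p => [_ ->//|p u _].
    rewrite rcons_path last_rcons => /andP[_ /existsP[e he]] ->.
    have [h1 h2] := same e0 e.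
    by case/orP: he => /andP[/eqP a1 /eqP a2]; [rewrite -a2 h2|rewrite -a1 h1].
  by move=> e; case: (same e e).
have vw v w : v = w by rewrite (v0E v) (v0E w).
have Weq := W_one_vertex vw.
have [e0 _] := edge_exists L0.
have aE : L = n * len e0.
  by rewrite {1}/total_length (eq_bigr (fun=> len e0)) ?sumr_const ?mulr_natl.
apply: (mulfI (lt0r_neq0 L2)); rewrite bE -mE Weq; apply/eqP.
rewrite -subr_eq0 tangent_sum// big1// => e _.
have -> : len e - L / n = 0 by rewrite (len_eq e e0) aE; field; lra.
by rewrite expr0n/= mul0r.
Qed.

End LowerBound.

(** * Growing a connected subgraph *)

Section Growth.
Variables (R : realType) (G : metric_graph R).
Implicit Types (x y z : point G) (e f : edge G) (S : seq (edge G)).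
Implicit Types (s t : R) (v w : vertex G) (d : edge G * bool).

(* The closed subgraph spanned by [S]; the base vertex [v0] turns the empty
   list into a one-point subgraph, from which every growth process starts. *)
Definition clo v0 S x : Prop := x = inl v0 \/
  exists e t, [/\ e \in S, 0 <= t <= len e & x = at_edge e t].

Lemma clo_mem v0 S e t : e \in S -> 0 <= t <= len e -> clo v0 S (at_edge e t).
Proof. by move=> eS ht; right; exists e, t. Qed.

Lemma clo_dpt v0 S d s : d.1 \in S -> 0 <= s <= len d.1 -> clo v0 S (dpt d s).
Proof.
move=> dS /andP[? ?]; apply: clo_mem => //.
by case: (d.2) => //; apply/andP; split; lra.
Qed.

Lemma clo_src v0 S d : d.1 \in S -> clo v0 S (inl (dsrc d)).
Proof. by move=> dS; rewrite -dpt0; apply: clo_dpt => //; exact: in0l. Qed.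

Lemma clo_tgt v0 S d : d.1 \in S -> clo v0 S (inl (dtgt d)).
Proof. by move=> dS; rewrite -dpt_len; apply: clo_dpt => //; exact: inll. Qed.

Lemma clo_sub v0 S S' x : {subset S <= S'} -> clo v0 S x -> clo v0 S' x.
Proof.
move=> SS' [->|[e [t [eS ht ->]]]]; first by left.
by apply: clo_mem => //; exact: SS'.
Qed.

Lemma clo_cat v0 S S' x : clo v0 (S ++ S') x -> clo v0 S x \/ clo v0 S' x.
Proof.
move=> [->|[e [t [+ ht ->]]]]; first by left; left.
by rewrite mem_cat => /orP[eS|eS]; [left|right]; exact: clo_mem.
Qed.

Lemma clo_cons v0 S d x : clo v0 (d.1 :: S) x ->
  clo v0 S x \/ exists2 s, 0 <= s <= len d.1 & x = dpt d s.
Proof.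
move=> [->|[e [t [+ ht ->]]]]; first by left; left.
rewrite inE => /predU1P[ee|eS]; last by left; exact: clo_mem.
right; move: ht; rewrite ee => /andP[? ?].
exists (if d.2 then t else len d.1 - t).
  by case: (d.2); apply/andP; split; lra.
exact: at_edge_dpt.
Qed.

(** Connectedness as an induction principle; darts cover both directions in which a walk may cross
    an edge. *)
Lemma vertex_ind (P : vertex G -> Prop) v0 : P v0 ->
  (forall d, P (dsrc d) -> P (dtgt d)) -> forall v, P v.
Proof.
move=> P0 H v; have /connectP[p hp ->] := graph_connected v0 v.
elim: p v0 P0 hp => [//|u p IH v0 P0 /= /andP[/existsP[e he] hp]].
apply: IH hp; case/orP: he => /andP[/eqP h1 /eqP h2]; rewrite -?h1 -?h2.
  by apply: (H (e, true)); rewrite /dsrc/= h1.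
by apply: (H (e, false)); rewrite /dsrc/= h2.
Qed.

(** Otherwise the vertices of the subgraph would be closed under darts, hence be all vertices, and
    then [e] itself would belong to [S]. *)
Lemma next_dart v0 S e : e \notin S ->
  exists2 d, d.1 \notin S & clo v0 S (inl (dsrc d)).
Proof.
move=> eS; apply: contrapT => no.
have H d : clo v0 S (inl (dsrc d)) -> d.1 \in S.
  by move=> h; apply: contrapT => /negP dS; apply: no; exists d.
have all v : clo v0 S (inl v).
  apply: (@vertex_ind (fun v => clo v0 S (inl v)) v0); first by left.
  by move=> d /H; exact: clo_tgt.
by move/negP: eS; apply; exact: (H (e, true)).
Qed.

(** Induction on the number of missing edges. A step may add several edges at once: one edge for the
    bound [L / 3], an ear for [L / 4]. *)
Lemma grow_ind v0 (P : seq (edge G) -> Prop) S0 : uniq S0 -> P S0 ->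
  (forall S d, uniq S -> d.1 \notin S -> clo v0 S (inl (dsrc d)) -> P S ->
     exists p, [/\ d.1 \in p, uniq (p ++ S) & P (p ++ S)]) ->
  exists S, [/\ uniq S, (forall e, e \in S) & P S].
Proof.
move=> u0 P0 H; have [k] := ubnP (#|edge G| - size S0).
elim: k S0 u0 P0 => [//|k IH] S0 u0 P0 hk.
case: (pselect (forall e, e \in S0)) => [a|/existsNP[e /negP eS]].
  by exists S0.
have [d dS cd] := next_dart v0 eS.
have [p [dp up Pp]] := H _ _ u0 dS cd P0.
apply: IH up Pp _.
have h : (size S0 < #|edge G|)%N.
  have := uniq_leq_size (s2 := enum (edge G)) (_ : uniq (d.1 :: S0)).
  by rewrite /= dS u0 -cardE => /(_ isT); apply => ? _; rewrite mem_enum.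
have p0 : (0 < size p)%N by case: (p) dp.
by rewrite size_cat -ltnS (leq_trans _ hk)// ltnS ltn_sub2l// -{1}[size S0]add0n ltn_add2r.
Qed.

Lemma clo_full v0 S x : (forall e, e \in S) -> clo v0 S x.
Proof.
move=> aS; case: (point_cases x) => [[v ->]|[e [t [/andP[? ?] ->]]]]; last first.
  by apply: clo_mem => //; rewrite !ltW.
apply: (@vertex_ind (fun v => clo v0 S (inl v)) v0); first by left.
by move=> d _; exact: clo_tgt.
Qed.

Lemma full_perm S : uniq S -> (forall e, e \in S) -> perm_eq S (enum (edge G)).
Proof.
move=> u a; apply: uniq_perm => //; first exact: enum_uniq.
by move=> e; rewrite mem_enum a.
Qed.

(** The distance is that of the whole graph, not the intrinsic one of the subgraph, so old terms do
    not change when [S] grows. *)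
Definition gW S : R := gint S (fun x => gint S (dist x)).

Lemma gW_perm S S' : perm_eq S S' -> gW S = gW S'.
Proof.
move=> p; rewrite /gW (gint_perm _ p); congr gint.
by apply/funext => x; exact: gint_perm.
Qed.

End Growth.

Lemma eq_gint (R : realType) (G : metric_graph R) (S : seq (edge G)) g h :
  (forall e t, e \in S -> 0 <= t <= len e -> g (at_edge e t) = h (at_edge e t)) ->
  gint S g = gint S h.
Proof.
move=> H; rewrite /gint big_seq [RHS]big_seq; apply: eq_bigr => e eS.
by apply: eq_itg => t ht; exact: H.
Qed.

(** * The upper bound L / 3 *)

Section AddEdge.
Variables (R : realType) (G : metric_graph R).
Variables (v0 : vertex G) (S : seq (edge G)) (d : edge G * bool).
Implicit Types (x y z : point G) (s t : R).

Local Notation v := (inl (dsrc d) : point G).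
Local Notation l := (len d.1).
Local Notation L' := (tlen S).
Local Notation A := (gint S (dist v)).
Local Notation T := (d.1 :: S).

(** The polynomial [(s ^+ 2 + (l - s) ^+ 2) / 2 + s * L' + A], expanded: the first term bounds the
    part on the new edge, the others the part on [S], reached through [v]. *)
Definition add_inner s : R := s ^+ 2 + ((L' - l) * s + (l ^+ 2 / 2 + A)).

Lemma lip_add_inner : lip 0 l add_inner.
Proof. by apply: lipD; [exact: lip_sqr|exact: lip_affine]. Qed.

Lemma itg_add_inner :
  itg 0 l add_inner = l ^+ 3 / 3 + L' * l ^+ 2 / 2 + l * A.
Proof.
rewrite itgD; [|exact: lip_sqr|exact: lip_affine].
by rewrite itg_sqr ?len_ge0// itg_affine ?len_ge0//; field.
Qed.

Lemma lip_dist_dart s : lip 0 l (dist (dpt d s) \o dpt d).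
Proof. exact/glip_dpt/glip_dist. Qed.

(** The counterpart of [add_inner] for a base point in [S]: the new edge is reached through [v]. *)
Definition add_old x : R := (l * dist v x + l ^+ 2 / 2) + gint S (dist x).

Lemma glip_add_old1 : glip (fun x => l * dist v x + l ^+ 2 / 2).
Proof. by apply: glipD; [apply: glipZ; exact: glip_dist|exact: glip_cst]. Qed.

Lemma glip_add_old : glip add_old.
Proof. by apply: glipD; [exact: glip_add_old1|exact: glip_gint]. Qed.

Lemma gint_add_old : gint S add_old = l * A + l ^+ 2 / 2 * L' + gW S.
Proof.
rewrite gintD; [|exact: glip_add_old1|exact: glip_gint].
rewrite gintD; [|apply: glipZ; exact: glip_dist|exact: glip_cst].
by rewrite gintZ ?gint_cst//; exact: glip_dist.
Qed.

Lemma eint_dist_shift c : itg 0 l (fun t => 1 * t + c) = c * l + l ^+ 2 / 2.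
Proof. by rewrite itg_affine ?len_ge0//; field. Qed.

Lemma dist_src s : 0 <= s <= l -> dist v (dpt d s) <= s.
Proof.
move=> hs; rewrite -dpt0; apply: le_trans (dist_dpt (in0l _) hs) _.
by rewrite sub0r normrN ger0_norm//; case/andP: hs.
Qed.

Lemma eint_old_le x : eint d.1 (dist x) <= l * dist v x + l ^+ 2 / 2.
Proof.
rewrite mulrC -eint_dist_shift (eint_dpt d (glip_dist x)).
apply: itg_le; [exact/glip_dpt/glip_dist|exact: lip_affine|].
move=> t ht /=; rewrite mul1r addrC.
by apply: le_trans (dist_tri v _ _) _; rewrite dist_sym lerD2l dist_src.
Qed.

Lemma eint_new_le s : 0 <= s <= l ->
  eint d.1 (dist (dpt d s)) <= (s ^+ 2 + (l - s) ^+ 2) / 2.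
Proof.
move=> hs; rewrite -itg_dist_pt// (eint_dpt d (glip_dist _)).
apply: itg_le; [exact/glip_dpt/glip_dist|exact: lip_dist_pt|].
by move=> t ht; exact: dist_dpt.
Qed.

Lemma gint_new_le s : 0 <= s <= l -> gint S (dist (dpt d s)) <= s * L' + A.
Proof.
move=> hs; rewrite -gint_cst -gintD; [|exact: glip_cst|exact: glip_dist].
apply: gint_le; [exact: glip_dist|by apply: glipD; [exact: glip_cst|exact: glip_dist]|].
move=> e t eS ht; apply: le_trans (dist_tri v _ _) _.
by rewrite lerD2r dist_sym dist_src.
Qed.

Lemma add_inner_ge s : 0 <= s <= l -> gint T (dist (dpt d s)) <= add_inner s.
Proof.
move=> hs; rewrite gint_cons; apply: le_trans (lerD (eint_new_le hs) (gint_new_le hs)) _.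
by rewrite /add_inner le_eqVlt; apply/orP; left; apply/eqP; field.
Qed.

Lemma gint_old_le : gint S (fun x => gint T (dist x)) <= gint S add_old.
Proof.
apply: gint_le; [exact: glip_gint|exact: glip_add_old|].
by move=> e t eS ht; rewrite gint_cons lerD2r eint_old_le.
Qed.

Lemma eint_add_le : eint d.1 (fun x => gint T (dist x)) <= itg 0 l add_inner.
Proof.
rewrite (eint_dpt d (glip_gint _)).
apply: itg_le; [exact/glip_dpt/glip_gint|exact: lip_add_inner|exact: add_inner_ge].
Qed.

Lemma gW_consE : gW T =
  eint d.1 (fun x => gint T (dist x)) + gint S (fun x => gint T (dist x)).
Proof. by rewrite /gW gint_cons. Qed.

(** The new edge against itself gives at most [l ^+ 3 / 3]; the mixed part, at most
    [l * A + L' * l ^+ 2 / 2], occurs twice. *)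
Lemma gW_cons_le :
  gW T <= gW S + 2 * (l * A) + L' * l ^+ 2 + l ^+ 3 / 3.
Proof.
rewrite gW_consE; apply: le_trans (lerD eint_add_le gint_old_le) _.
by rewrite itg_add_inner gint_add_old; lra.
Qed.

(* The equality case of the estimates above: the new edge sticks out of [v]. *)
Definition hanging : Prop :=
  (forall s t, 0 <= s <= l -> 0 <= t <= l -> dist (dpt d s) (dpt d t) = `|s - t|) /\
  (forall s x, 0 <= s <= l -> clo v0 S x -> dist (dpt d s) x = s + dist v x).

Section Hanging.
Hypotheses (cv : clo v0 S v) (hd : hanging).

Lemma hanging_old x : clo v0 S x -> eint d.1 (dist x) = l * dist v x + l ^+ 2 / 2.
Proof.
move=> cx; rewrite mulrC -eint_dist_shift (eint_dpt d (glip_dist x)).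
by apply: eq_itg => t ht /=; rewrite mul1r dist_sym; case: hd => _ ->.
Qed.

Lemma hanging_new s : 0 <= s <= l ->
  gint T (dist (dpt d s)) = (s ^+ 2 + (l - s) ^+ 2) / 2 + (s * L' + A).
Proof.
move=> hs; rewrite gint_cons; congr (_ + _).
  rewrite -itg_dist_pt// (eint_dpt d (glip_dist _)).
  by apply: eq_itg => t ht /=; case: hd => ->.
rewrite -gint_cst -gintD; [|exact: glip_cst|exact: glip_dist].
by apply: eq_gint => e t eS ht; case: hd => _ ->//; exact: clo_mem.
Qed.

Lemma hanging_gW : gW T = gW S + 2 * (l * A) + L' * l ^+ 2 + l ^+ 3 / 3.
Proof.
rewrite gW_consE (eint_dpt d (glip_gint _)).
rewrite (@eq_itg _ 0 l _ add_inner); last first.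
  by move=> t ht /=; rewrite hanging_new// /add_inner; field.
suff -> : gint S (fun x => gint T (dist x)) = gint S add_old.
  by rewrite itg_add_inner gint_add_old; lra.
apply: eq_gint => e t eS ht.
by rewrite gint_cons hanging_old//; exact: clo_mem.
Qed.

End Hanging.

(** Equality in the total forces equality in each integral estimate, then in each pointwise one by
    [itg_eq] and [gint_eq]. The disjunction ensures that the base vertex, which [clo] includes by
    convention, is covered too: it lies on an edge of [S], or it is [v]. *)
Lemma hanging_of_gW : clo v0 S v -> (S = [::] \/
    exists e t, [/\ e \in S, 0 <= t <= len e & inl v0 = at_edge e t]) ->
  gW S + 2 * (l * A) + L' * l ^+ 2 + l ^+ 3 / 3 <= gW T -> hanging.
Proof.
move=> cv cv0; rewrite gW_consE => H.
have inner s : 0 <= s <= l -> add_inner s = gint T (dist (dpt d s)).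
  move=> hs; apply/esym.
  apply: (@itg_eq _ 0 l ((fun x => gint T (dist x)) \o dpt d) add_inner) => //.
  - exact: len_gt0.
  - exact/glip_dpt/glip_gint.
  - exact: lip_add_inner.
  - exact: add_inner_ge.
  - rewrite -(eint_dpt d (glip_gint _)) itg_add_inner.
    by have := gint_old_le; rewrite gint_add_old; lra.
have both s : 0 <= s <= l ->
    (s ^+ 2 + (l - s) ^+ 2) / 2 <= eint d.1 (dist (dpt d s)) /\
    s * L' + A <= gint S (dist (dpt d s)).
  move=> hs; have := inner s hs; rewrite gint_cons.
  have := eint_new_le hs; have := gint_new_le hs.
  have -> : add_inner s = (s ^+ 2 + (l - s) ^+ 2) / 2 + (s * L' + A).
    by rewrite /add_inner; field.
  by move=> *; split; lra.
have old s e t : 0 <= s <= l -> e \in S -> 0 <= t <= len e ->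
    dist (dpt d s) (at_edge e t) = s + dist v (at_edge e t).
  move=> hs eS ht.
  apply: (@gint_eq _ _ S (dist (dpt d s)) (fun x => s + dist v x)) eS ht.
  - exact: glip_dist.
  - by apply: glipD; [exact: glip_cst|exact: glip_dist].
  - move=> e' t' _ ht'; apply: le_trans (dist_tri v _ _) _.
    by rewrite lerD2r dist_sym dist_src.
  - rewrite gintD; [|exact: glip_cst|exact: glip_dist].
    by rewrite gint_cst; case: (both s hs).
have new s t : 0 <= s <= l -> 0 <= t <= l -> dist (dpt d s) (dpt d t) = `|s - t|.
  move=> hs ht.
  apply: (@itg_eq _ 0 l (dist (dpt d s) \o dpt d) (fun t => `|s - t|)) ht.
  - exact: len_gt0.
  - exact: lip_dist_dart.
  - exact: lip_dist_pt.
  - by move=> r hr; exact: dist_dpt.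
  - by rewrite -(eint_dpt d (glip_dist _)) itg_dist_pt//; case: (both s hs).
split=> // s x hs [->|[e [t [eS ht ->]]]]; last exact: old.
case: cv0 => [S0|[e [t [eS ht ->]]]]; last exact: old.
move: cv; rewrite S0 => -[[<-]|[e [t [//]]]].
rewrite distxx addr0 -dpt0 new ?in0l// subr0 ger0_norm//.
by case/andP: hs.
Qed.

End AddEdge.

(** * The bound by induction on edges, with equality forcing an interval *)

Section Upper.
Variables (R : realType) (G : metric_graph R) (v0 : vertex G).
Implicit Types (x y z w : point G) (S : seq (edge G)) (s t r : R).

(* The subgraph [S] is an interval with ends [z] and [w]. The last clause says
   that only an end is as far as possible from [S] on average, which forces the
   next edge to be attached at an end. *)
Definition straight S z w : Prop :=
  [/\ clo v0 S z /\ clo v0 S w,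
      (forall x, clo v0 S x -> dist z x + dist x w = tlen S),
      (forall x y, clo v0 S x -> clo v0 S y ->
         dist x y = `|dist z x - dist z y|),
      (forall r, 0 <= r <= tlen S -> exists2 x, clo v0 S x & dist z x = r)
    & (forall x, clo v0 S x -> gint S (dist x) = tlen S ^+ 2 / 2 ->
         dist x z = 0 \/ dist x w = 0)].

Lemma straight_sym S z w : straight S z w -> straight S w z.
Proof.
move=> [[cz cw] h1 h2 h3 h4]; split=> //.
- by move=> x cx; rewrite addrC (dist_sym x z) (dist_sym w x) h1.
- move=> x y cx cy; rewrite h2// (dist_sym w x) (dist_sym w y).
  have := h1 x cx; have := h1 y cy => e1 e2.
  by rewrite distrC; congr (`| _ |); lra.
- move=> r /andP[r0 rl]; have [|x cx xr] := h3 (tlen S - r).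
    by apply/andP; split; lra.
  by exists x => //; have := h1 x cx; rewrite (dist_sym w x); lra.
- by move=> x cx /h4 -[]//; [right|left].
Qed.

(** The diameter bound serves to propagate the bound on inner integrals; the latter, taken at the
    attaching vertex, controls the growth of [gW]. *)
Definition upper_inv S : Prop :=
  [/\ (S = [::] \/
        exists e t, [/\ e \in S, 0 <= t <= len e & inl v0 = at_edge e t]),
      (forall x y, clo v0 S x -> clo v0 S y -> dist x y <= tlen S),
      (forall x, clo v0 S x -> gint S (dist x) <= tlen S ^+ 2 / 2),
      gW S <= tlen S ^+ 3 / 3
    & (gW S = tlen S ^+ 3 / 3 -> exists z w, straight S z w)].

Lemma clo_nil x : clo v0 [::] x -> x = inl v0.
Proof. by move=> [//|[e [t []]]]. Qed.

Lemma upper_inv_nil : upper_inv [::].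
Proof.
have g0 g : gint [::] g = 0 :> R by rewrite /gint big_nil.
have t0 : tlen ([::] : seq (edge G)) = 0 by rewrite /tlen big_nil.
have c0 : clo v0 [::] (inl v0) by left.
split.
- by left.
- by move=> x y /clo_nil-> /clo_nil->; rewrite distxx t0.
- by move=> x _; rewrite g0 t0; lra.
- by rewrite /gW g0 t0; lra.
- move=> _; exists (inl v0), (inl v0); split=> //.
  + by move=> x /clo_nil->; rewrite distxx t0 addr0.
  + by move=> x y /clo_nil-> /clo_nil->; rewrite distxx subrr normr0.
  + rewrite t0 => r /andP[r0 rl]; exists (inl v0) => //; rewrite distxx; lra.
  + by move=> x /clo_nil->; rewrite distxx; left.
Qed.

(** The attaching vertex is metrically the end [w], so the hanging edge prolongs the interval: [z]
    remains an end and the far end of [d] replaces [w]. *)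
Lemma straight_cons S d z w : upper_inv S -> clo v0 S (inl (dsrc d)) ->
  hanging v0 S d -> straight S z w -> dist (inl (dsrc d)) w = 0 ->
  gint S (dist (inl (dsrc d))) = tlen S ^+ 2 / 2 ->
  straight (d.1 :: S) z (dpt d (len d.1)).
Proof.
move=> [_ I1 I2 _ _] cv hd [[cz cw] h1 h2 h3 h4] vw A.
set v : point G := inl (dsrc d) in cv vw A *.
set l := len d.1; have l0 : 0 < l := len_gt0 d.1.
have [hn ho] := hd.
have sub x : clo v0 S x -> clo v0 (d.1 :: S) x.
  by apply: clo_sub => e eS; rewrite inE eS orbT.
have cd s : 0 <= s <= l -> clo v0 (d.1 :: S) (dpt d s).
  by apply: clo_dpt; rewrite mem_head.
have ll : 0 <= l <= l := inll d.1.
have zv x : clo v0 S x -> dist z x = tlen S - dist v x.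
  move=> cx; have := h1 x cx.
  have := dist_tri v x w; have := dist_tri w x v.
  rewrite (dist_sym w v) vw (dist_sym v x); lra.
have zd s : 0 <= s <= l -> dist z (dpt d s) = tlen S + s.
  by move=> hs; rewrite dist_sym ho// (dist_sym v) (zv v)// distxx subr0 addrC.
have tT : tlen (d.1 :: S) = l + tlen S by rewrite tlen_cons.
split.
- by split; [exact: sub|exact: cd].
- move=> x /clo_cons[cx|[s hs ->]].
    by rewrite (dist_sym x) ho// (zv x)// tT; ring.
  by rewrite zd// hn// ler0_norm ?tT; [ring|rewrite subr_le0; case/andP: hs].
- move=> x y /clo_cons[cx|[s hs ->]] /clo_cons[cy|[t ht ->]].
  + exact: h2.
  + rewrite dist_sym ho// zv// zd// ler0_norm; first by ring.
    have := dist_ge0 v x; case/andP: ht; lra.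
  + rewrite ho// zd// zv// ger0_norm; first by ring.
    have := dist_ge0 v y; case/andP: hs; lra.
  + by rewrite hn// !zd//; congr (`| _ |); ring.
- rewrite tT => r /andP[r0 rl]; case: (leP r (tlen S)) => rS.
    by have [|x cx xr] := h3 r; [rewrite r0|exists x => //; exact: sub].
  have hr : 0 <= r - tlen S <= l by apply/andP; split; lra.
  by exists (dpt d (r - tlen S)); [exact: cd|rewrite zd//; lra].
- move=> x /clo_cons[cx|[s hs ->]].
    (* For an old point, an extremal inner integral forces distance [tlen S] from [v], hence
       distance 0 from [z]. *)
    rewrite gint_cons (hanging_old hd cx) -/v -/l tT => xE; left.
    have := I2 x cx; have vx := I1 v x cv cx => gx.
    have : l * (tlen S - dist v x) <= 0 by nra.
    by rewrite pmulr_rle0// (dist_sym x z) zv// => ?; lra.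
  rewrite (hanging_new hd hs) -/v A tT -/l => xE.
  (* The first factor gives the far end. The second can vanish only if [s] and [tlen S] are both 0,
     when the point is [z]. *)
  have : (s - l) * (s + tlen S) = 0 by move: xE; nra.
  have tS := tlen_ge0 S; case/andP: (hs) => s0 sl.
  move=> /eqP; rewrite mulf_eq0 subr_eq0 => /orP[/eqP->|/eqP st].
    by right; rewrite distxx.
  by left; rewrite dist_sym zd//; lra.
Qed.

(** Since the inner integral at [v] is at most [tlen S ^+ 2 / 2], [gW] grows by at most a difference
    of cubes. Equality makes [S] tight, the inner integral at [v] extremal and the new edge
    hanging. *)
Lemma upper_inv_cons S d : clo v0 S (inl (dsrc d)) -> upper_inv S ->
  upper_inv (d.1 :: S).
Proof.
move=> cv inv; have [I0 I1 I2 I3 I4] := inv.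
set v : point G := inl (dsrc d) in cv *.
set l := len d.1; have l0 : 0 < l := len_gt0 d.1.
have tT : tlen (d.1 :: S) = l + tlen S by rewrite tlen_cons.
have tS := tlen_ge0 S.
have I2v := I2 v cv.
have lA : l * gint S (dist v) <= l * (tlen S ^+ 2 / 2) by rewrite ler_wpM2l// ltW.
have gle := gW_cons_le S d.
have cubeE : (l + tlen S) ^+ 3 / 3 = tlen S ^+ 3 / 3 +
    2 * (l * (tlen S ^+ 2 / 2)) + tlen S * l ^+ 2 + l ^+ 3 / 3 by field.
split.
- right; case: I0 => [S0|[e [t [eS ht ve]]]]; last first.
    by exists e, t; split=> //; rewrite inE eS orbT.
  move: cv; rewrite S0 => /clo_nil vE.
  exists d.1, (if d.2 then 0 else l); split; first exact: mem_head.
    by case: (d.2); [exact: in0l|exact: inll].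
  by rewrite -vE /v -dpt0 at_edge_dpt; congr dpt; case: (d.2); rewrite ?subrr.
- have vs x s : clo v0 S x -> 0 <= s <= l -> dist x (dpt d s) <= l + tlen S.
    move=> cx hs; apply: le_trans (dist_tri v _ _) _.
    have := I1 x v cx cv; have := dist_src hs; rewrite -/v; case/andP: hs; lra.
  rewrite tT => x y /clo_cons[cx|[s hs ->]] /clo_cons[cy|[t ht ->]].
  + by have := I1 x y cx cy; lra.
  + exact: vs.
  + by rewrite dist_sym; exact: vs.
  + apply: le_trans (dist_dpt hs ht) _; rewrite ler_norml -/l.
    by case/andP: hs; case/andP: ht; rewrite -/l => *; apply/andP; split; lra.
- rewrite tT => x /clo_cons[cx|[s hs ->]].
    have := eint_old_le d x; have := I2 x cx; have := I1 v x cv cx.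
    rewrite gint_cons -/v -/l => *.
    have : l * dist v x <= l * tlen S by rewrite ler_wpM2l// ltW.
    by move=> ?; nra.
  have := add_inner_ge S hs; rewrite /add_inner -/v -/l => *.
  case/andP: hs => s0; rewrite -/l => sl.
  (* The slack is [(l - s) * s + (l - s) * tlen S] plus the slack of the inner integral at [v]. *)
  have : 0 <= (l - s) * s by apply: mulr_ge0; lra.
  have : 0 <= (l - s) * tlen S by apply: mulr_ge0; lra.
  by nra.
- by rewrite tT cubeE; move: gle; rewrite -/v -/l; lra.
- rewrite tT cubeE => gE.
  have WS : gW S = tlen S ^+ 3 / 3 by move: gle; rewrite -/v -/l; lra.
  have lAE : l * gint S (dist v) = l * (tlen S ^+ 2 / 2).
    by move: gle; rewrite -/v -/l; lra.
  have AE : gint S (dist v) = tlen S ^+ 2 / 2 by exact: (mulfI (lt0r_neq0 l0)).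
  have hd : hanging v0 S d.
    by apply: hanging_of_gW => //; rewrite -/v -/l; lra.
  have [z [w st]] := I4 WS.
  have [_ _ _ _ ends] := st.
  (* The extremal inner integral makes [v] an end of the interval; if it is [z], the interval is
     reversed first. *)
  have [vz|vw] := ends v cv AE.
    exists w, (dpt d l); apply: straight_cons (straight_sym st) vz AE => //.
  by exists z, (dpt d l); apply: straight_cons st vw AE.
Qed.

Lemma upper_inv_full : exists S,
  [/\ uniq S, (forall e, e \in S) & upper_inv S].
Proof.
apply: (@grow_ind _ _ v0 upper_inv [::]) => //; first exact: upper_inv_nil.
move=> S d uS dS cd inv; exists [:: d.1]; split; first exact: mem_head.
  by rewrite /= dS.
exact: upper_inv_cons.
Qed.

Lemma straight_path_graph S z w : (forall e, e \in S) -> straight S z w ->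
  path_graph G.
Proof.
move=> aS [_ h1 h2 h3 _].
have all x : clo v0 S x by exact: clo_full.
exists 0, (tlen S); split; first exact: tlen_ge0.
exists (dist z); split; last by move=> x y; rewrite -h2.
apply/seteqP; split=> [_ [x _ <-]|r] /=; rewrite in_itv/=.
  have := h1 x (all x); have := dist_ge0 z x; have := dist_ge0 x w.
  by move=> *; apply/andP; split; lra.
by move=> /h3[x _ <-]; exists x.
Qed.

End Upper.

(** * Equality for intervals: the same induction is tight *)

Section PathConverse.
Variables (R : realType) (G : metric_graph R) (v0 : vertex G).
Variable f : point G -> R.
Hypothesis iso : forall x y, `|f x - f y| = dist x y.
Implicit Types (x y z w : point G) (S : seq (edge G)) (s t r : R).

(** Two points as far apart as the diameter bound allows make the other bounds of [upper_inv]
    equalities. *)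
Definition tight_inv S : Prop := upper_inv v0 S /\
  forall z w, clo v0 S z -> clo v0 S w -> tlen S <= dist z w ->
    gW S = tlen S ^+ 3 / 3 /\ gint S (dist z) = tlen S ^+ 2 / 2.

(** The route from [z] through [v] to the far end of the new edge is no longer than the distance, so
    it is a geodesic and no portion of it can be shortened. *)
Lemma hanging_tight S d z : upper_inv v0 S -> clo v0 S (inl (dsrc d)) ->
  clo v0 S z -> tlen S + len d.1 <= dist z (dpt d (len d.1)) ->
  hanging v0 S d.
Proof.
move=> [_ I1 _ _ _] cv cz zu; set l := len d.1 in zu *.
set v : point G := inl (dsrc d) in cv *.
have ll : 0 <= l <= l := inll d.1.
have vd s : 0 <= s <= l -> dist v (dpt d s) <= s by exact: dist_src.
have uv : dist v (dpt d l) <= l by exact: vd.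
have zv : dist z v = tlen S.
  by have := dist_tri v z (dpt d l); have := I1 z v cz cv; lra.
have end_le s : 0 <= s <= l -> dist (dpt d s) (dpt d l) <= l - s.
  move=> hs; apply: le_trans (dist_dpt hs ll) _.
  by rewrite distrC ger0_norm// subr_ge0; case/andP: hs.
have new s t : 0 <= s <= l -> 0 <= t <= l -> s <= t ->
    `|s - t| <= dist (dpt d s) (dpt d t).
  move=> hs ht st; rewrite distrC ger0_norm ?subr_ge0//.
  have := dist_tri v z (dpt d l); have := dist_tri (dpt d s) v (dpt d l).
  have := dist_tri (dpt d t) (dpt d s) (dpt d l).
  by have := vd s hs; have := end_le t ht; lra.
split=> [s t hs ht|s x hs cx].
  apply/eqP; rewrite eq_le (dist_dpt hs ht)/=.
  case: (leP s t) => [st|/ltW ts]; first exact: new.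
  by rewrite distrC dist_sym; exact: new.
apply/eqP; rewrite eq_le; apply/andP; split.
  apply: le_trans (dist_tri v _ _) _.
  by rewrite lerD2r dist_sym vd.
(* On the line, a point within [tlen S] of both [z] and [v] lies between them. *)
have between : dist z x + dist x v = tlen S.
  have := I1 z x cz cx; have := I1 x v cx cv; move: zv; rewrite -!iso.
  have [|] := leP 0 (f z - f x); have [|] := leP 0 (f x - f v);
    have [|] := leP 0 (f z - f v) => h1 h2 h3;
    rewrite ?(ger0_norm h1) ?(ger0_norm h2) ?(ger0_norm h3)
      ?(ltr0_norm h1) ?(ltr0_norm h2) ?(ltr0_norm h3); lra.
have := dist_tri x z (dpt d l); have := dist_tri (dpt d s) x (dpt d l).
by have := end_le s hs; rewrite (dist_sym v x) (dist_sym x (dpt d s)); lra.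
Qed.

Lemma tight_inv_cons S d : clo v0 S (inl (dsrc d)) -> tight_inv S ->
  tight_inv (d.1 :: S).
Proof.
move=> cv [inv H]; split; first exact: upper_inv_cons.
have [_ I1 _ _ _] := inv.
set v : point G := inl (dsrc d) in cv *.
set l := len d.1; have l0 : 0 < l := len_gt0 d.1.
have ll : 0 <= l <= l := inll d.1.
have tT : tlen (d.1 :: S) = tlen S + l by rewrite tlen_cons addrC.
have tS := tlen_ge0 S.
(* The main case, one point in [S] and one on the new edge: the latter must be the far end, and [z]
   and [v] are then at maximal distance within [S]. *)
have key z s : clo v0 S z -> 0 <= s <= l -> tlen S + l <= dist z (dpt d s) ->
    [/\ gW (d.1 :: S) = tlen (d.1 :: S) ^+ 3 / 3,
        gint (d.1 :: S) (dist z) = tlen (d.1 :: S) ^+ 2 / 2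
      & gint (d.1 :: S) (dist (dpt d s)) = tlen (d.1 :: S) ^+ 2 / 2].
  move=> cz hs zw; have vs := dist_src hs.
  have vz := I1 z v cz cv; have tr := dist_tri v z (dpt d s).
  have sl : s = l by rewrite -/v in vs; case/andP: hs; lra.
  rewrite sl in zw tr vs *.
  have zv : tlen S <= dist z v by rewrite -/v in vs; lra.
  have hd := hanging_tight inv cv cz zw.
  have [WS gz] := H z v cz cv zv.
  have [_ gv] : gW S = tlen S ^+ 3 / 3 /\ gint S (dist v) = tlen S ^+ 2 / 2.
    by apply: (H v z) => //; rewrite dist_sym.
  have zvE : dist v z = tlen S by rewrite dist_sym; lra.
  rewrite (hanging_gW hd) (hanging_new hd ll) gint_cons (hanging_old hd cz).
  by rewrite -/v -/l gv gz WS zvE tT; split; field.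
move=> z w cz cw; rewrite [X in X <= _]tT => zw.
case: (clo_cons cz) (clo_cons cw) => [cz'|[r hr zE]] [cw'|[s hs wE]].
- by have := I1 z w cz' cw'; lra.
- by rewrite wE in zw; have [] := key z s cz' hs zw.
- by rewrite zE dist_sym in zw; rewrite zE; have [] := key w r cw' hr zw.
(* Two points of the new edge that far apart are its ends; one of them is [v], which brings back the
   main case. *)
- have rs := dist_dpt hr hs; rewrite -zE -wE in rs.
  have [r0 rl] := andP hr; have [s0 sl] := andP hs; rewrite -/l in rl sl.
  case: (leP r s) => rs'.
    have z0 : r = 0 by move: rs; rewrite distrC ger0_norm; lra.
    have zv : z = v by rewrite zE z0 dpt0.
    by rewrite zv wE in zw *; have [] := key v s cv hs zw.
  have w0 : s = 0 by move: rs; rewrite ger0_norm; lra.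
  have wv : w = v by rewrite wE w0 dpt0.
  by rewrite wv zE dist_sym in zw; rewrite zE; have [] := key v r cv hr zw.
Qed.

Lemma gW_line z w : total_length G <= dist z w ->
  gW (enum (edge G)) = total_length G ^+ 3 / 3.
Proof.
have [S [uS aS [_ H]]] : exists S,
    [/\ uniq S, (forall e, e \in S) & tight_inv S].
  apply: (@grow_ind _ _ v0 tight_inv [::]) => //.
    split; first exact: upper_inv_nil.
    move=> z1 w1 _ _ _; rewrite /gW /gint /tlen !big_nil; split; lra.
  move=> S d uS dS cd inv; exists [:: d.1]; split; first exact: mem_head.
    by rewrite /= dS.
  exact: tight_inv_cons.
have p := full_perm uS aS.
rewrite total_lengthE -(tlen_perm p) -(gW_perm p) => zw.
by have [] := H z w (clo_full v0 z aS) (clo_full v0 w aS) zw.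
Qed.

End PathConverse.

(** * The length of a graph is at most that of an interval it maps to without shrinking distances *)

Section Packing.
Variables (R : realType) (G : metric_graph R) (a b : R) (f : point G -> R).
Hypothesis ab : a <= b.
Hypothesis f_itv : forall x, a <= f x <= b.
Hypothesis f_dist : forall x y, dist x y <= `|f x - f y|.

(* Points at coordinates (k + 1/2) r along the edges are pairwise at distance
   at least r, so no two of them fall in the same interval of length r. *)
Lemma packing r : 0 < r -> total_length G <= b - a + (#|edge G|%:R + 1) * r.
Proof.
move=> r0; pose n (e : edge G) := Num.truncn (len e / r).
pose K := (Num.truncn ((b - a) / r)).+1.
pose c (k : nat) : R := (k%:R + 1 / 2) * r.
have cn e k : (k < n e)%N -> r / 2 <= c k /\ c k <= len e - r / 2.
  rewrite truncn_gt_nat ler_pdivlMr// => h; rewrite /c; move: h.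
  rewrite -natr1; have : 0 <= k%:R :> R by []. 
  by split; nra.
have cin e k : (k < n e)%N -> 0 <= c k <= len e.
  by move=> /cn[? ?]; apply/andP; split; lra.
pose pt (u : {e : edge G & 'I_(n e)}) := at_edge (tag u) (c (tagged u)).
have sep u v : u != v -> r <= dist (pt u) (pt v).
  case: u => e [k hk]; case: v => e' [k' hk']; rewrite /pt/=.
  have [ck1 ck2] := cn _ _ hk; have [ck1' ck2'] := cn _ _ hk'.
  case: (eqVneq e e') => [ee|ee] neq; last first.
    apply: le_trans (le_dist_diff_edges ee (cin _ _ hk) (cin _ _ hk')).
    rewrite /to_end /Num.min; case: ifP => _; case: ifP => _; lra.
  subst e'; apply: le_trans (le_dist_same_edge (cin _ _ hk) (cin _ _ hk')).
  have kk : k != k'.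
    by apply: contraNneq neq => kk; subst k'; apply/eqP; congr (Tagged _ _); exact: val_inj.
  have h : r <= `|c k - c k'|.
    rewrite /c -mulrBl normrM (gtr0_norm r0) ler_peMl ?(ltW r0)//.
    rewrite opprD addrACA subrr addr0.
    by move: kk; rewrite neq_ltn => /orP[] kk; [rewrite distrC|];
      rewrite ger0_norm ?subr_ge0 ?ler_nat 1?ltnW// lerBrDl natr1 ler_nat.
  (* The margins of [r / 2] at both ends of the edge keep the other arc at least [r] long. *)
  rewrite /circle_dist le_min h/= lerBrDl -lerBrDr ler_norml.
  by apply/andP; split; lra.
have Klt u : (Num.truncn ((f (pt u) - a) / r) < K)%N.
  rewrite ltnS; apply: le_truncn.
  by rewrite ler_pM2r ?invr_gt0// lerD2r; case/andP: (f_itv (pt u)).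
have inj : injective (fun u => Ordinal (Klt u)).
  move=> u v [] tuv; apply/eqP; apply: contraT => /sep.
  have pos w : 0 <= (f (pt w) - a) / r.
    by rewrite divr_ge0 ?(ltW r0)// subr_ge0; case/andP: (f_itv (pt w)).
  have /andP := truncn_itv (pos u); have /andP := truncn_itv (pos v).
  rewrite tuv !ler_pdivlMr// !ltr_pdivrMr// -!natr1 => -[h1 h2] [h3 h4].
  have := f_dist (pt u) (pt v); have : `|f (pt u) - f (pt v)| < r.
    by rewrite ltr_norml; apply/andP; split; nra.
  by lra.
(* There are at most [K] sample points. An edge is at most [r] longer than its number of samples
   accounts for, and [K] intervals exceed [b - a] by at most [r]. *)
have := leq_card _ inj; rewrite card_ord card_tagged sumnE big_map big_enum/=.
under eq_bigr do rewrite card_ord.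
rewrite -(ler_nat R) natr_sum /K -natr1 => h.
have lenle e : len e <= ((n e)%:R + 1) * r.
  have /andP[_] := truncn_itv (divr_ge0 (len_ge0 e) (ltW r0)).
  by rewrite ltr_pdivrMr// -natr1 => /ltW.
have : total_length G <= (\sum_(e : edge G) (n e)%:R + #|edge G|%:R) * r.
  rewrite mulrDl mulr_suml.
  have -> : #|edge G|%:R * r = \sum_(e : edge G) r by rewrite sumr_const mulr_natl.
  rewrite -big_split/=; apply: ler_sum => e _.
  by have := lenle e; rewrite mulrDl mul1r.
have : (Num.truncn ((b - a) / r))%:R * r <= b - a.
  rewrite -ler_pdivlMr//; have ba : 0 <= b - a by rewrite subr_ge0.
  by have /andP[] := truncn_itv (divr_ge0 ba (ltW r0)).
nra.
Qed.

(** The limit of [packing] as [r] tends to 0: [r] is chosen so that the error term is half of the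
    supposed excess. *)
Lemma packing_le : total_length G <= b - a.
Proof.
rewrite leNgt; apply/negP => lt.
have E0 : (0 : R) <= #|edge G|%:R by [].
have := @packing ((total_length G - (b - a)) / (2 * (#|edge G|%:R + 1))).
have -> : (#|edge G|%:R + 1) *
  ((total_length G - (b - a)) / (2 * (#|edge G|%:R + 1))) =
  (total_length G - (b - a)) / 2 by field; lra.
have p : 0 < (total_length G - (b - a)) / (2 * (#|edge G|%:R + 1)).
  by rewrite divr_gt0//; lra.
by move=> /(_ p); lra.
Qed.

End Packing.

Section UpperBound.
Variables (R : realType) (G : metric_graph R).
Local Notation L := (total_length G).

Lemma mean_distance_gW : 0 < L -> gW (enum (edge G)) = L ^+ 2 * mean_distance G.
Proof.
by move=> L0; rewrite mean_distanceE mulrA divff ?mul1r// expf_neq0// lt0r_neq0.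
Qed.

Lemma vertex_exists : 0 < L -> exists v : vertex G, true.
Proof.
move=> L0; case: (pickP (@predT (edge G))) => [e _|no]; first by exists (org e).
by move: L0; rewrite /total_length big_pred0 ?ltxx// => e; have := no e.
Qed.

Lemma mean_distance_upper : 0 < L ->
  mean_distance G <= L / 3 /\ (mean_distance G = L / 3 <-> path_graph G).
Proof.
move=> L0; have L2 : 0 < L ^+ 2 by rewrite exprn_gt0.
have WE := mean_distance_gW L0; have [v0 _] := vertex_exists L0.
have cube : L ^+ 2 * (L / 3) = L ^+ 3 / 3 by field.
have [S [uS aS [_ _ _ Wle Weq]]] := upper_inv_full v0.
have p := full_perm uS aS.
rewrite (gW_perm p) (tlen_perm p) -total_lengthE in Wle Weq.
split; first by rewrite -(ler_pM2l L2) cube -WE.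
split=> [mE|[a [b [ab [f [rf iso]]]]]].
  have [|z [w st]] := Weq; first by rewrite WE mE cube.
  exact: straight_path_graph aS st.
have f_itv x : a <= f x <= b.
  have : range f (f x) by exists x.
  by rewrite rf/= in_itv.
have Lab : L <= b - a.
  by apply: (packing_le ab f_itv) => x y; rewrite iso.
have ex r : a <= r <= b -> exists x, f x = r.
  by move=> h; have : range f r; [rewrite rf/= in_itv|move=> [x _ <-]; exists x].
(* The preimages of the two ends of the interval are at distance [b - a], hence at least [L]. *)
have [z fz] := ex a ltac:(by rewrite lexx).
have [w fw] := ex b ltac:(by rewrite lexx andbT).
apply: (mulfI (lt0r_neq0 L2)); rewrite cube -WE.
apply: (@gW_line _ _ v0 f iso z w).
by rewrite -iso fz fw distrC ger0_norm ?subr_ge0.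
Qed.

End UpperBound.

(** * The upper bound L / 4 *)

Definition edges_of (R : realType) (G : metric_graph R)
  (p : seq (edge G * bool)) : seq (edge G) := [seq d.1 | d <- p].

Local Notation tl p := (tlen (edges_of p)).

(** * Bridgeless graphs, trails and the existence of ears *)

Section Bridgeless.
Variables (R : realType) (G : metric_graph R).
Implicit Types (x y z : point G) (e f : edge G) (S : seq (edge G)).
Implicit Types (u v w : vertex G) (d : edge G * bool).

Definition adj_off e : rel (vertex G) :=
  fun v w => [exists d : edge G * bool, [&& d.1 != e, dsrc d == v & dtgt d == w]].

Definition bridgeless : Prop := forall e, connect (adj_off e) (org e) (dst e).

Lemma adj_offI e d : d.1 != e -> adj_off e (dsrc d) (dtgt d).
Proof. by move=> de; apply/existsP; exists d; rewrite de !eqxx. Qed.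

Lemma adj_off_sym e : symmetric (adj_off e).
Proof.
have h v w : adj_off e v w -> adj_off e w v.
  move=> /existsP[[f b] /and3P[/= fe /eqP <- /eqP <-]].
  by have := @adj_offI e (f, ~~ b) fe; case: b.
by move=> v w; apply/idP/idP; exact: h.
Qed.

(** A discrete intermediate value argument: a label that differs at the ends of a path changes along
    one of its segments. *)
Lemma seg_cross (T : eqType) (h : point G -> T) (p : seq (segment G)) x y :
  is_path x p y -> h x != h y ->
  exists2 s, s \in p & valid_segment s /\
    h (at_edge (seg_edge s) (seg_from s)) != h (at_edge (seg_edge s) (seg_to s)).
Proof.
elim: p x => [x /= ->|s p IH x /= [vs -> hp] xy]; first by rewrite eqxx.
case: (eqVneq (h (at_edge (seg_edge s) (seg_from s)))
              (h (at_edge (seg_edge s) (seg_to s)))) => [e|ne].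
  have [|s' s'p H] := IH _ hp; first by rewrite -e.
  by exists s' => //; rewrite inE s'p orbT.
by exists s => //; rewrite mem_head.
Qed.

(* Were [e] a bridge, both paths would have to cross a common interior
   coordinate [r] of [e]. *)
Lemma doubly_bridgeless : doubly_connected G -> bridgeless.
Proof.
move=> dc e; apply/negP => /negP nconn.
have [p [q [hp hq pq]]] := dc (inl (org e)) (inl (dst e)).
(* Coordinates at which segments of the two paths start or stop. Below [m] none of them is positive,
   so [r] avoids them all and a crossing of [r] is interior to its segment. *)
pose cs := [seq seg_from s | s <- p ++ q] ++ [seq seg_to s | s <- p ++ q].
have [m [m0 ml mc]] : exists m, [/\ 0 < m, m <= len e &
    forall c, c \in cs -> c <= 0 \/ m <= c].
  elim: cs => [|a cs [m [m0 ml H]]]; first by exists (len e); split=> //; exact: len_gt0.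
  case: (leP a 0) => a0.
    by exists m; split=> // c; rewrite inE => /predU1P[->|/H//]; left.
  exists (Num.min a m); split=> [||c].
  - by rewrite lt_min a0.
  - by rewrite ge_min ml orbT.
  - rewrite inE => /predU1P[->|/H[]]; [right|by left|right].
      by rewrite ge_min lexx.
    by rewrite ge_min; apply/orP; right.
have [r [r0 rm]] : exists r, 0 < r /\ r < m by exists (m / 2); lra.
(* The label [h] marks what is connected to [org e] off [e], together with the part of [e] below
   [r]. It differs at the two ends of [e] and changes only at [r]. *)
pose C v := connect (adj_off e) (org e) v.
pose he f t := if f == e then t < r else C (org f).
pose h := pot C he.
have hE f t : 0 <= t <= len f -> h (at_edge f t) = he f t.
  apply: pot_at_edge; rewrite /he; case: eqP => [->|/eqP fe] //.
  - by rewrite /C connect0 r0.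
  - by rewrite /C (negPf nconn); apply/negbTE; rewrite -leNgt ltW// (lt_le_trans rm).
  - have := @adj_offI e (f, true) fe; rewrite /dsrc/dtgt/= => a.
    rewrite /C; apply/idP/idP => c.
      exact: connect_trans c (connect1 a).
    by apply: connect_trans c (connect1 _); rewrite adj_off_sym.
have cross (l : seq (segment G)) : is_path (inl (org e)) l (inl (dst e)) ->
    {subset l <= p ++ q} -> exists2 s, s \in l & seg_edge s = e /\ seg_interior s r.
  move=> hl sub.
  have [|s sl [[v1 v2]]] := seg_cross (h := h) hl.
    by rewrite /= /C connect0 (negPf nconn).
  rewrite !hE// /he; case: (eqVneq (seg_edge s) e) => [se|_]; last by rewrite eqxx.
  have sfrom : seg_from s \in cs by rewrite mem_cat map_f ?sub.
  have sto : seg_to s \in cs by rewrite mem_cat (map_f _ (sub _ sl)) orbT.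
  move=> ne; exists s => //; split=> //.
  rewrite /seg_interior /= in_itv /= gt_min lt_max; move: ne.
  have gt c : c \in cs -> r <= c -> r < c.
    by move=> /mc[c0 rc|mc' _]; [have := lt_le_trans r0 rc; lra|exact: lt_le_trans mc'].
  case: (ltP (seg_from s) r) => h1; case: (ltP (seg_to s) r) => h2 // _.
    by rewrite (gt _ sto h2) orbT.
  by rewrite (gt _ sfrom h1) orbT.
have [s sp [se sr]] := cross p hp ltac:(by move=> ? ?; rewrite mem_cat; apply/orP; left).
have [s' sq [se' sr']] := cross q hq ltac:(by move=> ? ?; rewrite mem_cat; apply/orP; right).
have : (seg_interior s `&` seg_interior s') r by [].
by rewrite (pq s s' sp sq _) // se se'.
Qed.

Implicit Types (s t : R).

(** Repeated edges are permitted here; distinctness is stated separately by [uniq (edges_of p)]. *)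
Fixpoint is_trail v (p : seq (edge G * bool)) w : Prop :=
  match p with
  | [::] => v = w
  | d :: p' => dsrc d = v /\ is_trail (dtgt d) p' w
  end.

(* The arc-length parametrization of the trail [p] ending at [w]. *)
Fixpoint gam w (p : seq (edge G * bool)) s : point G :=
  match p with
  | [::] => inl w
  | d :: p' => if s <= len d.1 then dpt d s else gam w p' (s - len d.1)
  end.

Lemma gam0 v p w : is_trail v p w -> gam w p 0 = inl v.
Proof. by case: p => [->//|d p [<- _] /=]; rewrite len_ge0 dpt0. Qed.

Lemma tl_cons d p : tl (d :: p) = len d.1 + tl p.
Proof. by rewrite /= tlen_cons. Qed.

Lemma tl_nil : tl ([::] : seq (edge G * bool)) = 0.
Proof. by rewrite /tlen big_nil. Qed.

Lemma gam_end v p w : is_trail v p w -> gam w p (tl p) = inl w.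
Proof.
elim: p v => [//|d p IH v [_ hp]]; rewrite tl_cons /=.
case: ifP => [le|_]; last by rewrite addrC addKr; exact: IH hp.
have p0 : tl p = 0 by have := tlen_ge0 (edges_of p); lra.
rewrite p0 addr0 dpt_len; case: p hp p0 {IH le} => [/= ->//|d' p _].
rewrite tl_cons => h; exfalso.
by have := tlen_ge0 (edges_of p); have := len_gt0 d'.1; lra.
Qed.

(** At [s = len d.1] both branches of [gam] give the junction vertex. *)
Lemma gam_cons v d p w s : is_trail v (d :: p) w -> len d.1 <= s ->
  gam w (d :: p) s = gam w p (s - len d.1).
Proof.
move=> [_ hp]; rewrite le_eqVlt => /predU1P[<-|ls] /=.
  by rewrite lexx subrr (gam0 hp) dpt_len.
by rewrite leNgt ls.
Qed.

Lemma gam_dist v p w s t : is_trail v p w -> 0 <= s <= tl p -> 0 <= t <= tl p ->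
  dist (gam w p s) (gam w p t) <= `|s - t|.
Proof.
wlog st : s t / s <= t.
  move=> H hp hs ht; case: (leP s t) => [st|/ltW ts]; first exact: H.
  by rewrite dist_sym distrC; exact: H.
elim: p v s t st => [|d p IH] v s t st hv; first by rewrite /= distxx.
rewrite tl_cons => /andP[s0 sl] /andP[t0 tl_].
have [_ hp] := hv; have l0 := len_gt0 d.1.
case: (leP (len d.1) s) => ls.
  rewrite !(gam_cons hv)//; last by lra.
  apply: le_trans (IH _ _ _ _ hp _ _) _; [lra| | |]; try by apply/andP; split; lra.
  by rewrite le_eqVlt; apply/orP; left; apply/eqP; congr (`| _ |); ring.
case: (leP (len d.1) t) => lt; last first.
  by rewrite /= (ltW ls) (ltW lt); apply: dist_dpt; apply/andP; split; lra.
apply: le_trans (dist_tri (dpt d (len d.1)) _ _) _.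
have -> : `|s - t| = `|s - len d.1| + `|0 - (t - len d.1)|.
  by rewrite !ler0_norm; lra.
apply: lerD.
  by rewrite /= (ltW ls); apply: dist_dpt; apply/andP; split; lra.
rewrite (gam_cons hv)// dpt_len -(gam0 hp); apply: IH hp _ _; first by lra.
  by rewrite lexx tlen_ge0.
by apply/andP; split; lra.
Qed.

Lemma lip_gam x v p w a b : is_trail v p w -> 0 <= a -> b <= tl p ->
  lip a b (dist x \o gam w p).
Proof.
move=> hp a0 bl; exists 1 => // s t /andP[? ?] /andP[? ?] /=.
rewrite mul1r (dist_sym x) (dist_sym x (gam w p t)).
by apply: le_trans (dist_lip _ _ _) (gam_dist hp _ _); apply/andP; split; lra.
Qed.

Lemma gint_gam x v p w : is_trail v p w ->
  gint (edges_of p) (dist x) = itg 0 (tl p) (dist x \o gam w p).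
Proof.
elim: p v => [|d p IH] v hv; first by rewrite tl_nil itg_point /gint big_nil.
have [_ hp] := hv; have p0 := tlen_ge0 (edges_of p).
rewrite tl_cons (_ : edges_of (d :: p) = d.1 :: edges_of p)// gint_cons (IH _ hp).
rewrite [RHS](@itg_split _ 0 (len d.1)) ?len_ge0 ?lerDl//; last first.
  by apply: (lip_gam _ hv) => //; rewrite tl_cons.
congr (_ + _).
  rewrite (eint_dpt d (glip_dist x)); apply: eq_itg => t /andP[_ tl_] /=.
  by rewrite tl_.
have := @itg_shift _ 0 (tl p) (len d.1) (dist x \o gam w (d :: p)) p0.
rewrite add0r (addrC (tl p)) => ->.
  apply: eq_itg => t /andP[t0 _] /=; rewrite -[if _ then _ else _]/(gam w (d :: p) _).
  by rewrite (gam_cons hv) ?lerDr// addrK.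
by apply: (lip_gam _ hv); rewrite ?len_ge0 ?tl_cons.
Qed.

Lemma gam_surj v p w e t : is_trail v p w -> e \in edges_of p ->
  0 <= t <= len e -> exists2 s, 0 <= s <= tl p & gam w p s = at_edge e t.
Proof.
elim: p v => [//|d p IH] v hv; rewrite inE tl_cons => eS ht.
have [_ hp] := hv; have p0 := tlen_ge0 (edges_of p); have d0 := len_gt0 d.1.
case/predU1P: eS => [ed|eS]; last first.
  have [s /andP[? ?] sE] := IH _ hp eS ht.
  exists (s + len d.1); first by apply/andP; split; lra.
  by rewrite (gam_cons hv) ?addrK//; lra.
move: ht; rewrite ed => /andP[? ?]; exists (if d.2 then t else len d.1 - t).
  by case: (d.2); apply/andP; split; lra.
by rewrite /= at_edge_dpt ifT//; case: (d.2); lra.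
Qed.

Lemma clo_gam v0 S v p w y : is_trail v p w -> clo v0 (edges_of p ++ S) y ->
  clo v0 S y \/ exists2 s, 0 <= s <= tl p & y = gam w p s.
Proof.
move=> hp /clo_cat[[->|[e [t [eS ht ->]]]]|]; [by left; left| |by left].
by right; have [s hs <-] := gam_surj hp eS ht; exists s.
Qed.

(** The walk is cut at its first vertex on [S]; an edge used before that cannot be in [S], as its
    source would be on [S]. Keeping the ends of all edges within [u :: q] shows by induction that no
    edge recurs, since the walk repeats no vertex. *)
Lemma ear_path v0 S e q u : path (adj_off e) u q -> uniq (u :: q) ->
  clo v0 S (inl (last u q)) ->
  exists p w, [/\ is_trail u p w, clo v0 S (inl w), uniq (edges_of p) &
    forall f, f \in edges_of p ->
      [/\ f != e, f \notin S, org f \in u :: q & dst f \in u :: q]].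
Proof.
elim: q u => [|u' q IH] u.
  by move=> _ _ /= cu; exists [::], u.
rewrite [path _ _ _]/= => /andP[/existsP[d /and3P[de /eqP du /eqP du']] hq].
rewrite cons_uniq => /andP[uq uu'] cl.
case: (pselect (clo v0 S (inl u))) => cu; first by exists [::], u.
have [p [w [hp cw up H]]] := IH u' hq uu' cl.
have dn f : f \in edges_of p -> f != d.1.
  move=> fp; apply: contraNneq uq => fd; have [_ _] := H f fp.
  by rewrite fd -du /dsrc; case: (d.2).
exists (d :: p), w; split=> //=.
- by split=> //; rewrite du'.
- by rewrite up andbT; apply/negP => /dn; rewrite eqxx.
- move=> f; rewrite inE => /predU1P[->|fp]; last first.
    have [a1 a2 a3 a4] := H f fp; split=> //.
      by rewrite inE a3 orbT.
    by rewrite inE a4 orbT.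
  split=> //.
  + by apply/negP => dS; apply: cu; rewrite -du; exact: clo_src.
  + by move: du du'; rewrite /dsrc /dtgt; case: (d.2) => <- <-;
      rewrite !inE eqxx ?orbT.
  + by move: du du'; rewrite /dsrc /dtgt; case: (d.2) => <- <-;
      rewrite !inE eqxx ?orbT.
Qed.

(** After crossing [d], bridgelessness gives a way back to its source that avoids [d.1]; it is
    followed until it first meets [S]. *)
Lemma ear_exists v0 S d : bridgeless -> uniq S -> d.1 \notin S ->
  clo v0 S (inl (dsrc d)) ->
  exists p w, [/\ is_trail (dsrc d) (d :: p) w, clo v0 S (inl w) &
    uniq (edges_of (d :: p) ++ S)].
Proof.
move=> br uS dS cd.
have : connect (adj_off d.1) (dtgt d) (dsrc d).
  rewrite /dtgt /dsrc; case: (d.2) => //.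
  by rewrite (sym_connect_sym (@adj_off_sym _)).
move=> /connectP[q0 hq0 lq0].
have [p [w [hp cw up H]]] : exists p w, [/\ is_trail (dtgt d) p w,
    clo v0 S (inl w), uniq (edges_of p) &
    forall f, f \in edges_of p -> f != d.1 /\ f \notin S].
  move: lq0; case/shortenP: hq0 => q hq uq _ lq.
  have [|p [w [h1 h2 h3 h4]]] := @ear_path v0 S d.1 q (dtgt d) hq uq.
    by rewrite -lq.
  by exists p, w; split=> // f /h4[].
exists p, w; split=> //.
rewrite cat_uniq uS andbT; apply/andP; split.
  by rewrite /= up andbT; apply/negP => /H[]; rewrite eqxx.
apply/hasPn => f fS /=; rewrite inE negb_or; apply/andP; split.
  by apply: contraNneq dS => <-.
by apply/negP => /H[_]; rewrite fS.
Qed.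

End Bridgeless.

(** * Growth by ears, and the equality case of circles *)

Section Ears.
Variables (R : realType) (G : metric_graph R).
Hypothesis br : bridgeless G.
Implicit Types (x y z : point G) (e f : edge G) (S : seq (edge G)).
Implicit Types (s t : R) (u v w : vertex G) (d : edge G * bool).
Implicit Types (p : seq (edge G * bool)).
Local Notation L := (total_length G).
Local Notation EE := (enum (edge G)).

(* The slack [k] carries a strict inequality through the addition of ears. *)
Definition ear_inv v0 x k S : Prop :=
  (forall y, clo v0 S y -> dist x y <= tlen S / 2) /\
  gint S (dist x) <= tlen S ^+ 2 / 4 - k.

Lemma tlen_cat S S' : tlen (S ++ S') = tlen S + tlen S'.
Proof. by rewrite /tlen big_cat. Qed.

Lemma gint_cat S S' g : gint (S ++ S') g = gint S g + gint S' g.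
Proof. by rewrite /gint big_cat. Qed.

Lemma ear_dist_le x v p w s : is_trail v p w -> 0 <= s <= tl p ->
  dist x (gam w p s) <=
  Num.min (s + dist x (inl v)) (tl p - s + dist x (inl w)).
Proof.
move=> hp hs; have [s0 sl] := andP hs; have p0 := tlen_ge0 (edges_of p).
have h0 : (0 : R) <= 0 <= tl p by rewrite lexx.
have h1 : 0 <= tl p <= tl p by rewrite lexx andbT.
rewrite le_min; apply/andP; split.
- apply: le_trans (dist_tri (inl v) _ _) _; rewrite addrC lerD2r -(gam0 hp); apply: le_trans (gam_dist hp h0 hs) _.
  by rewrite sub0r normrN ger0_norm.
- apply: le_trans (dist_tri (inl w) _ _) _; rewrite addrC lerD2r -(gam_end hp); apply: le_trans (gam_dist hp h1 hs) _.
  by rewrite ger0_norm// subr_ge0.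
Qed.

Lemma lip_ear_bound a b (c1 c2 c3 : R) :
  lip a b (fun s => Num.min (s + c1) (c2 - s + c3)).
Proof.
apply: lip_min; first by apply: lipD; [exact: lip_id|exact: lip_cst].
apply: lipD; last exact: lip_cst.
by apply: lipD; [exact: lip_cst|exact/lipN/lip_id].
Qed.

Lemma lip_half a b (c1 l : R) :
  lip a b (fun s => c1 + Num.min s (l - s)).
Proof. by apply: lipD; [exact: lip_cst|exact: lip_to_end]. Qed.

Lemma itg_half (c1 l : R) : 0 <= l ->
  itg 0 l (fun s => c1 + Num.min s (l - s)) = c1 * l + l ^+ 2 / 4.
Proof.
move=> l0; rewrite itgD; [|exact: lip_cst|exact: lip_to_end].
by rewrite itg_cst// itg_to_end// subr0.
Qed.

Lemma ear_bound_le (c1 c2 c l s : R) : c1 <= c -> c2 <= c ->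
  Num.min (s + c1) (l - s + c2) <= c + Num.min s (l - s).
Proof.
by move=> *; rewrite /Num.min; case: (ltP (s + c1)) => ?; case: (ltP s) => ?; lra.
Qed.

(** The ends of the ear are within [tlen S / 2] of [x], so its point [s] is within
    [tlen S / 2 + Num.min s (tl p - s)]. The integral of this bound completes the square
    [(tlen S + tl p) ^+ 2 / 4]. *)
Lemma ear_inv_cat v0 x k S v p w : is_trail v p w ->
  clo v0 S (inl v) -> clo v0 S (inl w) -> ear_inv v0 x k S ->
  ear_inv v0 x k (edges_of p ++ S).
Proof.
move=> hp cv cw [I1 I2]; have p0 := tlen_ge0 (edges_of p).
have pt s : 0 <= s <= tl p -> dist x (gam w p s) <= tlen S / 2 + Num.min s (tl p - s).
  by move=> hs; apply: le_trans (ear_dist_le x hp hs) _; apply: ear_bound_le; exact: I1.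
split; rewrite tlen_cat.
  move=> y /(clo_gam hp)[/I1|[s hs ->]]; first by lra.
  apply: le_trans (pt s hs) _; rewrite /Num.min; case: ltP => ?; lra.
rewrite gint_cat (gint_gam x hp).
have : itg 0 (tl p) (dist x \o gam w p) <= tlen S / 2 * tl p + tl p ^+ 2 / 4.
  by rewrite -itg_half//; apply: itg_le;
    [exact: (lip_gam x hp)|exact: lip_half|exact: pt].
by move: I2; set a := tlen S; set b := tl p; nra.
Qed.

Lemma ear_inv_full v0 x k S0 : uniq S0 -> ear_inv v0 x k S0 ->
  gint EE (dist x) <= L ^+ 2 / 4 - k.
Proof.
move=> u0 I0; have [S [uS aS [_]]] : exists S,
    [/\ uniq S, (forall e, e \in S) & ear_inv v0 x k S].
  apply: (@grow_ind _ _ v0 (ear_inv v0 x k) S0 u0 I0) => S d uS dS cd inv.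
  have [p [w [hp cw up]]] := ear_exists br uS dS cd.
  exists (edges_of (d :: p)); split=> //; first exact: mem_head.
  exact: ear_inv_cat hp cd cw inv.
have pS := full_perm uS aS.
by rewrite (gint_perm _ pS) (tlen_perm pS) -total_lengthE.
Qed.

(** An ear attached to a one-point subgraph is a cycle. *)
Lemma cycle_exists e : exists p, is_trail (org e) ((e, true) :: p) (org e) /\
  uniq (edges_of ((e, true) :: p)).
Proof.
have [|p [w [hp /clo_nil[wE]]]] := @ear_exists _ _ (org e) [::] (e, true) br isT isT.
  by left.
by rewrite cats0 => up; exists p; split=> //; rewrite wE in hp.
Qed.

Section Cycle.
Variables (v0 : vertex G) (p : seq (edge G * bool)).
Hypothesis hp : is_trail v0 p v0.
Local Notation c := (tl p).

Lemma cycle_dist_le s t : 0 <= s <= c -> 0 <= t <= c ->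
  dist (gam v0 p s) (gam v0 p t) <= circle_dist c s t.
Proof.
move=> hs ht; rewrite /circle_dist le_min (gam_dist hp hs ht)/=.
wlog st : s t hs ht / s <= t.
  move=> H; case: (leP s t) => [st|/ltW ts]; first exact: H.
  by rewrite dist_sym distrC; exact: H.
have [s0 sl] := andP hs; have [t0 tl_] := andP ht.
have h0 : (0 : R) <= 0 <= c by rewrite lexx (le_trans s0 sl).
have h1 : 0 <= c <= c by rewrite lexx (le_trans s0 sl).
(* The other arc passes through the base vertex, which has both parameters 0 and [c]. *)
have := dist_tri (inl v0) (gam v0 p s) (gam v0 p t).
have := gam_dist hp hs h0; have := gam_dist hp h1 ht.
rewrite (gam0 hp) (gam_end hp) (distrC s t) !ger0_norm; lra.
Qed.

Lemma circle_dist_half s t : circle_dist c s t <= c / 2.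
Proof. by rewrite /circle_dist /Num.min; case: ltP => ?; lra. Qed.

Lemma gint_cycle s : gint (edges_of p) (dist (gam v0 p s)) =
  itg 0 c (dist (gam v0 p s) \o gam v0 p).
Proof. exact: gint_gam hp. Qed.

Lemma ear_inv_cycle s : 0 <= s <= c -> ear_inv v0 (gam v0 p s) 0 (edges_of p).
Proof.
move=> hs; split.
  rewrite -{1}[edges_of p]cats0 => y /(clo_gam hp) [/clo_nil->|[t ht ->]].
    rewrite -(gam0 hp); apply: le_trans (cycle_dist_le hs _) (circle_dist_half _ _).
    by rewrite lexx tlen_ge0.
  exact: le_trans (cycle_dist_le hs ht) (circle_dist_half _ _).
rewrite gint_cycle subr0 -(itg_circ hs); apply: itg_le.
- exact: (lip_gam _ hp).
- exact: lip_circ.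
- by move=> t ht; exact: cycle_dist_le.
Qed.

End Cycle.

Lemma on_edge x : 0 < L -> exists e t, 0 <= t <= len e /\ x = at_edge e t.
Proof.
move=> L0; have [v0 _] := vertex_exists L0; have [e0 _] := edge_exists L0.
have [->|[e [t [_ ht ->]]]] := @clo_full _ _ (org e0) EE x (fun e => mem_enum _ e).
  by exists e0, 0; rewrite in0l at_edge0.
by exists e, t.
Qed.

(** Every point lies on some cycle, and the growth by ears starts from that one. *)
Lemma inner_le x : 0 < L -> gint EE (dist x) <= L ^+ 2 / 4.
Proof.
move=> /(on_edge x)[e [t [ht ->]]]; have [p [hp up]] := cycle_exists e.
have -> : at_edge e t = gam (org e) ((e, true) :: p) t.
  by rewrite /= (andP ht).2.
rewrite -[leRHS]subr0; apply: (@ear_inv_full (org e) _ _ (edges_of ((e, true) :: p))) => //.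
apply: ear_inv_cycle => //; rewrite tl_cons /=.
by have [? ?] := andP ht; have ? := tlen_ge0 (edges_of p); apply/andP; split; lra.
Qed.

Lemma gW_le : 0 < L -> gW EE <= L ^+ 3 / 4.
Proof.
move=> L0; have -> : L ^+ 3 / 4 = gint EE (fun=> L ^+ 2 / 4).
  by rewrite gint_cst -total_lengthE; field.
apply: gint_le; [exact: glip_gint|exact: glip_cst|].
by move=> e t _ _; exact: inner_le.
Qed.

Lemma inner_eq x : 0 < L -> L ^+ 3 / 4 <= gW EE -> gint EE (dist x) = L ^+ 2 / 4.
Proof.
move=> L0 Wge; have [e [t [ht ->]]] := on_edge x L0.
apply: (@gint_eq _ _ EE (fun x => gint EE (dist x)) (fun=> L ^+ 2 / 4)) ht.
- exact: glip_gint.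
- exact: glip_cst.
- by move=> e' t' _ _; exact: inner_le.
- by rewrite gint_cst -total_lengthE; move: Wge; rewrite /gW; lra.
- by rewrite mem_enum.
Qed.

(* Seen from the point where an ear is attached, the ear is too close. *)
Lemma cycle_full v0 p : is_trail v0 p v0 -> uniq (edges_of p) -> 0 < tl p ->
  0 < L -> L ^+ 3 / 4 <= gW EE -> forall e, e \in edges_of p.
Proof.
move=> hp up c0 L0 Wge e; apply: contraT => eC.
have [d dC cd] := next_dart v0 eC.
have [q [w [hq cw uq]]] := ear_exists br up dC cd.
set P := d :: q in hq uq *; set v := dsrc d in cd hq *.
(* The attaching vertex lies on the cycle, so distances can be measured from it. *)
have [s hs vE] : exists2 s, 0 <= s <= tl p & inl v = gam v0 p s.
  move: cd; rewrite -{1}[edges_of p]cats0 => /(clo_gam hp)[/clo_nil->|//].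
  by exists 0; rewrite ?(gam0 hp)// lexx ltW.
have [I1 I2] : ear_inv v0 (inl v) 0 (edges_of p) by rewrite vE; exact: ear_inv_cycle.
have l0 : 0 < tl P.
  by rewrite tl_cons; have := len_gt0 d.1; have := tlen_ge0 (edges_of q); lra.
set C := edges_of p in I1 I2 uq *; set l := tl P in l0 *.
(* [psi] is the generic bound along an ear. Seen from [v], where the ear starts at distance 0, it
   improves to [phi], strictly so at 0; the gap between their integrals becomes the slack [k]. *)
pose phi s := Num.min (s + 0) (l - s + tlen C / 2).
pose psi s := tlen C / 2 + Num.min s (l - s).
have philt : itg 0 l phi < itg 0 l psi.
  rewrite ltNge; apply/negP => le.
  have lphi : lip 0 l phi by exact: lip_ear_bound.
  have lpsi : lip 0 l psi by exact: lip_half.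
  have pp t : 0 <= t <= l -> phi t <= psi t.
    by move=> _; apply: ear_bound_le => //; rewrite divr_ge0// ltW.
  have := itg_eq l0 lphi lpsi pp le (_ : (0 : R) <= 0 <= l).
  rewrite lexx (ltW l0) => /(_ isT); rewrite /phi /psi.
  by rewrite !min_l; lra.
have dle t : 0 <= t <= l -> dist (inl v) (gam w P t) <= phi t.
  move=> ht; apply: le_trans (ear_dist_le _ hq ht) _.
  rewrite distxx /phi le_min ge_min lexx /= ge_min; apply/orP; right.
  by rewrite lerD2l I1.
have : gint EE (dist (inl v)) <= L ^+ 2 / 4 - (itg 0 l psi - itg 0 l phi).
  apply: (@ear_inv_full v0 _ _ (edges_of P ++ C) uq).
  have [J1 _] := ear_inv_cat hq cd cw (conj I1 I2); split=> //.
  rewrite gint_cat (gint_gam _ hq) tlen_cat -/l.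
  have : itg 0 l (dist (inl v) \o gam w P) <= itg 0 l phi.
    by apply: itg_le => //; [exact: (lip_gam _ hq)|exact: lip_ear_bound].
  rewrite [itg 0 l psi]itg_half ?(ltW l0)//; move: I2 => /=; set a := tlen C.
  move: (itg 0 l phi) (itg 0 l _) (gint C _) => i1 i2 i3 ? ?.
  nra.
rewrite inner_eq//; lra.
Qed.

Lemma loop_of_gW : 0 < L -> L ^+ 3 / 4 <= gW EE -> loop_graph G.
Proof.
move=> L0 Wge; have [e0 _] := edge_exists L0.
have [q [hp up]] := cycle_exists e0.
set v0 := org e0 in hp; set p := (e0, true) :: q in hp up.
have c0 : 0 < tl p.
  by rewrite tl_cons /=; have := len_gt0 e0; have := tlen_ge0 (edges_of q); lra.
have aC := cycle_full hp up c0 L0 Wge.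
have pC := full_perm up aC.
have cL : tl p = L by rewrite total_lengthE; exact: tlen_perm.
have circ s t : 0 <= s <= tl p -> 0 <= t <= tl p ->
    dist (gam v0 p s) (gam v0 p t) = circle_dist (tl p) s t.
  move=> hs ht.
  apply: (@itg_eq _ 0 (tl p) (dist (gam v0 p s) \o gam v0 p)
    (circle_dist (tl p) s)) ht => //.
  - exact: (lip_gam _ hp).
  - exact: lip_circ.
  - by move=> r hr; exact: cycle_dist_le.
  - by rewrite itg_circ// -gint_cycle// (gint_perm _ pC) inner_eq// cL.
(* The isometry inverts [gam]; parameter [tl p] is traded for 0, which gives the same point. *)
have /choice[f fP] : forall x, exists s, 0 <= s < tl p /\ gam v0 p s = x.
  move=> x; have [e [t [ht ->]]] := on_edge x L0.
  have [s /andP[s0 +] sE] := gam_surj hp (aC e) ht.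
  rewrite le_eqVlt => /predU1P[sc|sc]; last by exists s; rewrite s0.
  by exists 0; rewrite lexx c0 (gam0 hp) -sE sc (gam_end hp).
have fin x : 0 <= f x <= tl p.
  by have [/andP[? ?] _] := fP x; apply/andP; split; lra.
exists (tl p); split=> //; exists f; split; last first.
  by move=> x y; rewrite -circ// (fP x).2 (fP y).2.
apply/seteqP; split=> [_ [x _ <-]|r] /=; rewrite in_itv/=; first by have [] := fP x.
move=> /andP[r0 rc]; exists (gam v0 p r) => //.
(* Two parameters of one point are at circle distance 0. Both lie in [[0, tl p[], so the
   complementary arc has positive length and they coincide. *)
have := circ (f (gam v0 p r)) r (fin _); rewrite (fP _).2 distxx r0 ltW// => /(_ isT).
have [/andP[h1 h2] _] := fP (gam v0 p r).
rewrite /circle_dist => /esym; rewrite /Num.min.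
have : `|f (gam v0 p r) - r| < tl p by rewrite ltr_norml; apply/andP; split; lra.
move=> h; case: ltP => _ h'; last by lra.
by move/eqP: h'; rewrite normr_eq0 subr_eq0 => /eqP.
Qed.

Lemma gW_of_loop : 0 < L -> loop_graph G -> gW EE = L ^+ 3 / 4.
Proof.
move=> L0 [c [c0 [f [rf iso]]]].
have fin x : 0 <= f x < c.
  have : range f (f x) by exists x.
  by rewrite rf/= in_itv.
(* The circle distance never exceeds the distance of parameters, so the packing argument applies to
   the interval of length [c]. *)
have Lc : L <= c.
  rewrite -[leRHS]subr0; apply: (@packing_le _ _ 0 c f) => //; first exact: ltW.
    by move=> x; have /andP[? ?] := fin x; apply/andP; split; lra.
  by move=> x y; rewrite -iso /circle_dist ge_min lexx.
have anti x : exists x', forall y, dist x y + dist y x' = c / 2.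
  have [x' x'E] : exists x', f x' = if f x < c / 2 then f x + c / 2 else f x - c / 2.
    have /= : range f (if f x < c / 2 then f x + c / 2 else f x - c / 2).
      rewrite rf/= in_itv/=; have /andP[? ?] := fin x.
      by case: ltP => ?; apply/andP; split; lra.
    by move=> [x' _ <-]; exists x'.
  by exists x' => y; rewrite -!iso x'E circle_dist_antipode.
have inner x : gint EE (dist x) = L ^+ 2 / 4.
  (* The integrals from [x] and from its antipode add up to [c / 2 * L], hence to at least
     [L ^+ 2 / 2], while neither exceeds [L ^+ 2 / 4]. *)
  apply/eqP; rewrite eq_le inner_le//=; have [x' x'E] := anti x.
  have : gint EE (dist x) + gint EE (dist x') = c / 2 * L.
    rewrite -gintD; [|exact: glip_dist|exact: glip_dist].
    rewrite total_lengthE -gint_cst; apply: eq_gint => e t _ _.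
    by rewrite (dist_sym x').
  have := inner_le x' L0; nra.
rewrite /gW (_ : (fun x => _) = fun=> L ^+ 2 / 4); last exact/funext.
by rewrite gint_cst -total_lengthE; field.
Qed.

End Ears.

Lemma mean_distance_doubly (R : realType) (G : metric_graph R) :
  0 < total_length G -> doubly_connected G ->
  mean_distance G <= total_length G / 4 /\
  (mean_distance G = total_length G / 4 <-> loop_graph G).
Proof.
set L := total_length G => L0 /doubly_bridgeless br.
have L2 : 0 < L ^+ 2 by rewrite exprn_gt0.
have WE := mean_distance_gW L0.
have cube : L ^+ 2 * (L / 4) = L ^+ 3 / 4 by field.
split; first by rewrite -(ler_pM2l L2) cube -WE; exact: gW_le.
split=> [mE|lp].
  by apply: loop_of_gW => //; rewrite WE mE cube.
by apply: (mulfI (lt0r_neq0 L2)); rewrite cube -WE; exact: gW_of_loop.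
Qed.

Theorem theorem3p2 (R : realType) (G : metric_graph R) (L : R) (E : nat)
    (hL : total_length G = L) (hL_gt0 : 0 < L) (hE : #|edge G| = E) :
  [/\ (2 * E%:R - 1) / (4 * E%:R ^+ 2) * L <= mean_distance G <= L / 3,
      mean_distance G = (2 * E%:R - 1) / (4 * E%:R ^+ 2) * L
        <-> equilateral_flower G,
      mean_distance G = L / 3 <-> path_graph G
    & doubly_connected G ->
        mean_distance G <= L / 4 /\
        (mean_distance G = L / 4 <-> loop_graph G)].
Proof.
subst L E.
have [lo loE] := mean_distance_lower hL_gt0.
have [up upE] := mean_distance_upper hL_gt0.
split=> //; first by rewrite lo up.
exact: mean_distance_doubly.
Qed.
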